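(* Let $m,p,n$ be positive integers with $p\mid m$ and let $w\in G(m,p,n)$. Then $[\mathrm{id},w]_{\ell_R}=[\mathrm{id},w]_{\mathrm{cdf}}$ if and only if both of the following hold: (1) the multiset of cycle weights of $w$ that are not $\equiv 0 \pmod p$ can be partitioned into pairs whose two weights sum to $0$ in $\mathbb{Z}/m\mathbb{Z}$ (equivalently, $\ell_R(w)=\operatorname{codim}\operatorname{fix}(w)$); and (2) for every set $S$ of cycles of $w$ whose weights sum to $0 \pmod p$, the set $S$ can be partitioned into singletons $\{C\}$ with $C$ of weight $\equiv 0\pmod p$ and pairs $\{C,C'\}$ of cycles whose weights sum to $0$ in $\mathbb{Z}/m\mathbb{Z}$.
   Context: Let $m,p,n$ be positive integers with $p\mid m$ and $\zeta=e^{2\pi i/m}$. The group $G(m,1,n)$ consists of pairs $w=[u;a]$ with $u\in\mathfrak S_n$ (the underlying permutation) and $a=(a_1,\dots,a_n)\in(\mathbb Z/m\mathbb Z)^n$ (the weights); $[u;a]$ is identified with the $n\times n$ monomial matrix having entry $\zeta^{a_i}$ in position $(u(i),i)$ and zeros elsewhere, the group law is matrix multiplication, and the group acts on $\mathbb C^n$. A cycle of $w$ is a cycle of $u$ (fixed points count as cycles of size $1$); $c(w)$ is the number of cycles of $w$ and $c_0(w)$ the number of cycles of weight $0$, where the weight of a set $I\subseteq[n]$ (e.g. the underlying set of a cycle) is $\sum_{i\in I}a_i\in\mathbb Z/m\mathbb Z$, and $\mathrm{wt}(w)=\sum_{i=1}^n a_i$. Since $p\mid m$, it makes sense to say an element of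 $\mathbb Z/m\mathbb Z$ is $\equiv 0\pmod p$. $G(m,p,n)=\{w\in G(m,1,n):\mathrm{wt}(w)\equiv 0\pmod p\}$. A reflection is an element $g$ whose fixed space $\operatorname{fix}(g)=\ker(g-1)\subseteq\mathbb C^n$ has codimension $1$; $R$ is the set of reflections of $G(m,p,n)$ (they generate the group). $\ell_R(g)$ is the minimum number of reflections whose product is $g$, and $\operatorname{codim}\operatorname{fix}(g)=n-\dim\operatorname{fix}(g)$. For $f\in\{\ell_R,\operatorname{codim}\operatorname{fix}\}$ define $x\le_f y$ iff $f(x)+f(x^{-1}y)=f(y)$ (a partial order), and $[\mathrm{id},w]_f=\{u: u\le_f w\}$; the subscript $\mathrm{cdf}$ means $f=\operatorname{codim}\operatorname{fix}$. *)

(* Defs.v *)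
From HB Require Import structures.
From mathcomp Require Import all_boot all_order all_algebra all_fingroup all_field.
Set Implicit Arguments. Unset Strict Implicit. Unset Printing Implicit Defensive.
Import Order.TTheory GRing.Theory Num.Theory.

(* Elements [u; a] of G(m,1,n): underlying permutation u and weights a_i in Z/mZ,
   represented by residues in 'I_m (m > 0). *)
Definition elt (m n : nat) := ('S_n * {ffun 'I_n -> 'I_m})%type.

(* zeta = e^{2 pi i / m}: m.-root (-1) is e^{i pi / m} in algC. *)
Definition zeta (m : nat) : algC := ((m.-root (-1 : algC)) ^+ 2)%R.

Definition mx (m n : nat) (w : elt m n) : 'M[algC]_n :=
  \matrix_(r < n, c < n) (if r == w.1 c then zeta m ^+ w.2 c else 0)%R.

Definition wtset (m n : nat) (a : {ffun 'I_n -> 'I_m}) (I : {set 'I_n}) : nat :=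
  (\sum_(i in I) (a i : nat)) %% m.

Definition wt (m n : nat) (w : elt m n) : nat := wtset w.2 [set: 'I_n].

Definition inG (m p n : nat) (w : elt m n) : bool := wt w %% p == 0.

(* cycles of w (fixed points included) *)
Definition cycles (m n : nat) (w : elt m n) : {set {set 'I_n}} := porbits w.1.

(* codim fix(g) = n - dim ker(g - 1) acting on column vectors C^n *)
Definition codimfix (n : nat) (g : 'M[algC]_n) : nat :=
  n - \rank (kermx ((g - 1%:M)^T))%R.

Definition is_reflection (m p n : nat) (r : elt m n) : bool :=
  inG p r && (codimfix (mx r) == 1).

Definition prodmx (m n : nat) (s : seq (elt m n)) : 'M[algC]_n :=
  foldr (fun r A => mulmx (mx r) A) 1%:M%R s.

Definition lR (m p n : nat) (g : 'M[algC]_n) (k : nat) : Prop :=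
  (exists s : seq (elt m n), all (@is_reflection m p n) s /\ size s = k /\ prodmx s = g)
  /\ (forall s : seq (elt m n), all (@is_reflection m p n) s -> prodmx s = g -> k <= size s).

Definition le_lR (m p n : nat) (x y : elt m n) : Prop :=
  exists a b c, lR m p (mx x) a /\ lR m p (mulmx (invmx (mx x)) (mx y)) b /\
                lR m p (mx y) c /\ a + b = c.

Definition le_cdf (m n : nat) (x y : elt m n) : Prop :=
  codimfix (mx x) + codimfix (mulmx (invmx (mx x)) (mx y)) = codimfix (mx y).

Definition good_partition (m p n : nat) (a : {ffun 'I_n -> 'I_m})
    (allow_single : bool) (S : {set {set 'I_n}}) : Prop :=
  exists P : {set {set {set 'I_n}}},
    partition P S /\
    forall B, B \in P ->
      (allow_single && [exists C, (B == [set C]) && (wtset a C %% p == 0)])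
      || ((#|B| == 2) && ((\sum_(C in B) wtset a C) %% m == 0)).

(* Main.v *)
From mathcomp Require Import all_boot all_order all_algebra all_fingroup all_field.
From mathcomp Require Import ring lra zify.
Require Import Defs.
Set Implicit Arguments. Unset Strict Implicit. Unset Printing Implicit Defensive.
Import Order.TTheory GRing.Theory Num.Theory.
Local Open Scope ring_scope.

(* Let N_w(v) be the number of cycles of weight v of w, so that
   codim fix(w) = n - N_w(0).  Right multiplication by a reflection merges two
   cycles, splits a cycle, or shifts the weight of one cycle by a multiple of p.
   When this raises N(0), it can only remove an opposite pair of weights or a
   weight divisible by p from the multiset of nonzero weights.  Hence
   l_R(w) = codim fix(w) iff the weights not divisible by p pair off into
   opposites ([paired]), and, applying the same remark to G(m,1,n), where the two
   functions agree, x <=_cdf w makes the nonzero weights of x a sub-multiset of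
   those of w.  This gives the "if" part.  Conversely, if the intervals agree,
   each tail of a shortest factorization of w is paired: a step of the
   factorization that does not change the codimension would put the root of the
   reflection in two independent moved spaces.  Restricting w to a set S of
   cycles then gives an element below w, whose pairedness is condition (2). *)

(** * Primitivity of zeta *)

(** For z = a + ib and e = c + id on the upper half circle, the angle of e is positive and at most
    that of z, so dividing z by e stays on this half circle and moves strictly to the right. *)
Lemma unit_circle_div (R : realFieldType) (a b c d : R) :
  a ^+ 2 + b ^+ 2 = 1 -> c ^+ 2 + d ^+ 2 = 1 -> 0 <= b -> 0 <= d ->
  a <= c -> c != 1 -> 0 <= b * c - a * d /\ a < a * c + b * d.
Proof.
move=> ab cd b0 d0 ac c1.
have {}c1 : c < 1 by rewrite lt_neqAle c1 /=; nra.
have a1 : a <= 1 by nra.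
have [a0|a0] := leP 0 a.
  have bd : d <= b by nra.
  split; first by nra.
  have h1 : d * d <= b * d by nra.
  have : 0 < (1 - c) * (1 + c - a) by apply: mulr_gt0; lra.
  by nra.
split; last by nra.
have [c0|c0] := leP 0 c; first by nra.
have bd : b <= d by nra.
by nra.
Qed.

Lemma unit_circle_divC (z e : algC) :
  `|z| = 1 -> `|e| = 1 -> 0 <= 'Im z -> 0 <= 'Im e -> 'Re z <= 'Re e ->
  e != 1 -> 0 <= 'Im (z / e) /\ 'Re z < 'Re (z / e).
Proof.
move=> nz ne iz ie rze e1.
pose a := in_algR (Creal_Re z); pose b := in_algR (Creal_Im z).
pose c := in_algR (Creal_Re e); pose d := in_algR (Creal_Im e).
have nE (x : algC) : `|x| = 1 -> 'Re x ^+ 2 + 'Im x ^+ 2 = 1.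
  by move=> nx; rewrite -normC2_Re_Im nx expr1n.
have eV : e^-1 = e^* by rewrite invC_norm ne expr1n invr1 mul1r.
have -> : z / e = ('Re z * 'Re e + 'Im z * 'Im e)
     + 'i * ('Im z * 'Re e - 'Re z * 'Im e).
  rewrite eV {1}[z]Crect {1}[e]Crect conjC_rect //.
  move: ('Re z) ('Im z) ('Re e) ('Im e) => x y u v.
  transitivity (x * u - ('i ^+ 2) * (y * v) + 'i * (y * u - x * v)); first by ring.
  by rewrite sqrCi mulN1r opprK.
rewrite Im_rect ?Re_rect ?rpredD ?rpredN ?rpredM //.
have [||||||h1 h2] := @unit_circle_div algR a b c d.
- by apply: val_inj; rewrite /= -!expr2; exact: nE.
- by apply: val_inj; rewrite /= -!expr2; exact: nE.
- by [].
- by [].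
- by [].
- apply: contra_neq e1 => /(congr1 val) /= re1.
  have := nE e ne; rewrite re1 expr1n => /(canRL (addKr _)).
  rewrite addNr => /eqP; rewrite sqrf_eq0 => /eqP ie0.
  by rewrite [e]Crect re1 ie0 mulr0 addr0.
- by split.
Qed.

(** The root [r] has the largest real part among the m-th roots of -1 in the upper half plane. This
    maximality extends to all 2m-th roots of unity other than 1 there, and repeated division by [r]
    then exhibits each of them as a power of [r]. *)
Lemma prim_rootC_N1 m : (0 < m)%N -> (2 * m).-primitive_root (m.-root (-1 : algC)).
Proof.
move=> m0; set r := m.-root _.
have rm : r ^+ m = -1 by rewrite rootCK.
have nU k (z : algC) : (0 < k)%N -> z ^+ k = 1 -> `|z| = 1.
  move=> k0 zk; apply/eqP; rewrite -(@pexpr_eq1 _ _ k) ?normr_ge0 //.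
  by rewrite -normrX zk normr1.
have m20 : (0 < 2 * m)%N by rewrite muln_gt0.
have r2m : r ^+ (2 * m) = 1 by rewrite mulnC exprM rm sqrrN expr1n.
have nr := nU _ _ m20 r2m.
have ir : 0 <= 'Im r.
  have [m1|m1] := leqP m 1; last exact: Im_rootC_ge0.
  have m1' : m = 1%N by apply/eqP; rewrite eqn_leq m1.
  by rewrite /r m1' root1C (Creal_ImP _ _) // rpredN rpred1.
have r1 : r != 1.
  apply/eqP=> r1; move: rm; rewrite r1 expr1n => /eqP.
  by rewrite -addr_eq0 (pnatr_eq0 _ 2).
have maxr z : z ^+ (2 * m) = 1 -> 0 <= 'Im z -> z != 1 -> 'Re z <= 'Re r.
  move=> z2m iz z1; have nz := nU _ _ m20 z2m.
  have : (z ^+ m) ^+ 2 == 1 by rewrite -exprM mulnC z2m.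
  rewrite sqrf_eq1 => /orP[] /eqP zm; last exact: rootC_Re_max.
  (* An m-th root of 1 to the right of [r] would make [r / z] an m-th root of -1 in the upper half
     plane lying to the right of [r]. *)
  rewrite real_leNgt ?Creal_Re //; apply/negP => lt.
  have [i1 lt1] := unit_circle_divC nr nz ir iz (ltW lt) z1.
  have /(rootC_Re_max m0)/(_ i1) : (r / z) ^+ m = -1.
    by rewrite exprMn exprVn rm zm invr1 mulr1.
  by rewrite -/r => /(lt_le_trans lt1); rewrite ltxx.
have [w pw] := C_prim_root_exists m20.
(* Induction measure: dividing [z] by [r] moves it to the right, and the index of [z / r] leaves the
   set. *)
pose above (z : algC) := [set k : 'I_(2 * m) | 'Re z < 'Re (w ^+ k)].
have gen_up z : z ^+ (2 * m) = 1 -> 0 <= 'Im z -> exists k, z = r ^+ k.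
  have [N] := ubnP #|above z|; elim: N z => // N IH z ltN z2m iz.
  have [->|z1] := eqVneq z 1; first by exists 0%N; rewrite expr0.
  have nz := nU _ _ m20 z2m.
  have [i1 lt1] := unit_circle_divC nz nr iz ir (maxr z z2m iz z1) r1.
  have zr2m : (z / r) ^+ (2 * m) = 1 by rewrite exprMn exprVn z2m r2m invr1 mulr1.
  have [|//|//|k zrk] := IH (z / r).
    rewrite -ltnS; apply: leq_trans _ ltN; rewrite ltnS.
    apply/proper_card/properP; split.
      by apply/subsetP => k; rewrite !inE; apply: lt_trans.
    have [k zk] := prim_rootP pw zr2m; exists k; rewrite !inE -zk ?ltxx //.
  exists k.+1; rewrite exprSr -zrk divfK //.
  by rewrite -normr_gt0 nr ltr01.
(* Either [w] or its inverse, which is its conjugate, lies in the upper half plane, and the inverse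
   of [r] is again a power of [r]. *)
have [k wk] : exists k, w = r ^+ k.
  have w2m := prim_expr_order pw; have nw := nU _ _ m20 w2m.
  have wV : w^-1 = w^* by rewrite invC_norm nw expr1n invr1 mul1r.
  have : 'Im w \is Num.real by [].
  rewrite realE => /orP[/(gen_up _ w2m)//|iw].
  have [||k wk] := gen_up w^-1.
  - by rewrite exprVn w2m invr1.
  - by rewrite wV Im_conj oppr_ge0.
  have rn1 : r ^+ (2 * m).-1 = r^-1.
    have r0 : r != 0 by rewrite -normr_gt0 nr ltr01.
    by apply: (mulfI r0); rewrite -exprS prednK // r2m mulfV.
  by exists ((2 * m).-1 * k)%N; rewrite exprM rn1 exprVn -wk invrK.
have [d pd dvd] := prim_order_exists m20 r2m.
suff -> : (2 * m)%N = d by [].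
apply/eqP; rewrite eqn_dvd dvd andbT (prim_order_dvd pw).
by rewrite wk exprAC (prim_expr_order pd) expr1n.
Qed.

Lemma prim_zeta m : (0 < m)%N -> m.-primitive_root (zeta m).
Proof.
move=> m0; have := dvdn_prim_root (prim_rootC_N1 m0) (dvdn_mull 2 (dvdnn m)).
by rewrite mulnK.
Qed.

(** * Codimension of the fixed space *)

Section CodimFix.
Variable n : nat.
Implicit Types x y t : 'M[algC]_n.

Lemma codimfixE x : codimfix x = \rank (x - 1%:M).
Proof. by rewrite /codimfix mxrank_ker mxrank_tr subKn ?rank_leq_row. Qed.

Lemma codimfix1 : codimfix (1%:M : 'M[algC]_n) = 0%N.
Proof. by rewrite codimfixE subrr mxrank0. Qed.

(** The row space of [x - 1%:M] serves as the moved space mov x. The inclusion follows from xy - 1 =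
    (x - 1) + x(y - 1). *)
Lemma mov_mul_sub x y : (x *m y - 1%:M <= (x - 1%:M) + (y - 1%:M))%MS.
Proof.
have -> : x *m y - 1%:M = (x - 1%:M) + x *m (y - 1%:M).
  by rewrite mulmxBr mulmx1 [RHS]addrC addrA subrK.
by rewrite addmx_sub_adds // submxMl.
Qed.

Lemma codimfixM x y : (codimfix (x *m y) <= codimfix x + codimfix y)%N.
Proof.
rewrite !codimfixE; apply: leq_trans (mxrankS (mov_mul_sub x y)) _.
exact: mxrank_adds_leqif.
Qed.

(** The space mov x + mov y contains mov(xy), so additivity of dimensions leaves no room for an
    intersection. *)
Lemma mov_disjoint x y : codimfix (x *m y) = (codimfix x + codimfix y)%N ->
  ((x - 1%:M) :&: (y - 1%:M))%MS = 0.
Proof.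
rewrite !codimfixE => e; have := mxrankS (mov_mul_sub x y).
rewrite e -mxrank_sum_cap -{2}[\rank (_ + _)%MS]addn0 leq_add2l leqn0 mxrank_eq0.
by move/eqP.
Qed.

Lemma mov_inv x : x \in unitmx -> (invmx x - 1%:M :=: x - 1%:M)%MS.
Proof.
move=> ux; have -> : invmx x - 1%:M = (- invmx x) *m (x - 1%:M).
  by rewrite mulmxBr mulNmx mulVmx // mulmx1 opprK addrC.
apply: eqmxMfull; rewrite row_full_unit -scaleN1r unitmxZ ?unitrN1 //.
by rewrite unitmx_inv.
Qed.

Lemma codimfix_inv x : x \in unitmx -> codimfix (invmx x) = codimfix x.
Proof. by move=> ux; rewrite !codimfixE (mov_inv ux). Qed.

Lemma codimfix_conj x y : x \in unitmx ->
  codimfix (invmx x *m y *m x) = codimfix y.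
Proof.
move=> ux; rewrite !codimfixE.
have -> : invmx x *m y *m x - 1%:M = invmx x *m ((y - 1%:M) *m x).
  by rewrite mulmxBl mulmxBr mul1mx mulVmx // mulmxA.
rewrite eqmxMfull ?row_full_unit ?unitmx_inv //.
by rewrite mxrankMfree // row_free_unit.
Qed.

Definition unitary x := invmx x = (map_mx Num.conj x)^T.

(* [x] and [t] being unitary, the moved space is the orthogonal complement of
   the fixed space, so [fix x <= fix t] gives [mov t <= mov x]. *)
Lemma mov_sub_of_fix_sub x t : x \in unitmx -> t \in unitmx ->
  unitary x -> unitary t ->
  (kermx (x - 1%:M) <= kermx (t - 1%:M))%MS -> (t - 1%:M <= x - 1%:M)%MS.
Proof.
move=> ux ut Ux Ut /sub_kermxP K.
have /submxP[D /(congr1 trmx)] : ((t - 1%:M)^T <= (x - 1%:M)^T)%MS.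
  have sub_ker : ((x - 1%:M)^T <= kermx (kermx (x - 1%:M))^T)%MS.
    by apply/sub_kermxP; rewrite -trmx_mul mulmx_ker trmx0.
  have -> : ((x - 1%:M)^T :=: kermx (kermx (x - 1%:M))^T)%MS.
    apply/eqmxP; rewrite sub_ker /= -(geq_leqif (mxrank_leqif_sup sub_ker)).
    by rewrite mxrank_ker !mxrank_tr mxrank_ker subKn // rank_leq_row.
  by apply/sub_kermxP; rewrite -trmx_mul K trmx0.
rewrite trmx_mul !trmxK => /(congr1 (fun A => (map_mx Num.conj A)^T)).
rewrite map_mxM trmx_mul !map_mxB !linearB /= -Ux -Ut map_scalar_mx.
rewrite rmorph1 tr_scalar_mx => e.
by rewrite -(mov_inv ut) -(mov_inv ux) e -mulmxBr submxMl.
Qed.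

(** If the line mov t met mov x trivially, a vector fixed by xt would be fixed by x and by t. Equal
    codimensions would then give fix x = fix(xt), contained in fix t, and unitarity turns this into
    mov t inside mov x. *)
Lemma reflection_mov_sub x t : x \in unitmx -> t \in unitmx ->
  unitary x -> unitary t -> codimfix t = 1%N ->
  codimfix (x *m t) = codimfix x -> (t - 1%:M <= x - 1%:M)%MS.
Proof.
move=> ux ut Ux Ut; rewrite !codimfixE => t1 e.
apply: contraT => nsub.
have cap0 : ((t - 1%:M) :&: (x - 1%:M))%MS = 0.
  apply/eqP; rewrite -mxrank_eq0 -leqn0 -ltnS -t1.
  have := mxrank_leqif_sup (capmxSl (t - 1%:M) (x - 1%:M)).
  by rewrite sub_capmx submx_refl /= => /ltn_leqif ->.
have xtE : x *m t - 1%:M = (x - 1%:M) + x *m (t - 1%:M).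
  by rewrite mulmxBr mulmx1 [RHS]addrC addrA subrK.
have key : forall v : 'rV_n, v *m (x *m t - 1%:M) = 0 ->
    v *m (x - 1%:M) = 0 /\ v *m (t - 1%:M) = 0.
  move=> v; rewrite xtE mulmxDr mulmxA => /eqP; rewrite addr_eq0 => /eqP vE.
  have vx0 : v *m (x - 1%:M) = 0.
    apply/eqP; rewrite -submx0 -cap0 sub_capmx submxMl andbT vE.
    by rewrite -mulNmx submxMl.
  split=> //; move/eqP: vE; rewrite vx0 eq_sym oppr_eq0 => /eqP <-.
  by congr (_ *m _); move/eqP: vx0; rewrite mulmxBr mulmx1 subr_eq0 => /eqP ->.
have ker1 : (kermx (x *m t - 1%:M) <= kermx (x - 1%:M))%MS.
  apply/rV_subP => v /sub_kermxP /key[vx _]; exact/sub_kermxP.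
have ker2 : (kermx (x *m t - 1%:M) <= kermx (t - 1%:M))%MS.
  apply/rV_subP => v /sub_kermxP /key[_ vt]; exact/sub_kermxP.
have ker3 : (kermx (x - 1%:M) <= kermx (x *m t - 1%:M))%MS.
  by rewrite -(geq_leqif (mxrank_leqif_sup ker1)) !mxrank_ker e.
case/negP: nsub; apply: mov_sub_of_fix_sub => //.
exact: submx_trans ker3 ker2.
Qed.

(* With equality in both steps, the root of [t] lies in [mov x] and in
   [mov (t *m y)], so these spaces are not independent. *)
Lemma no_flat_reflection x t y : x \in unitmx -> t \in unitmx -> y \in unitmx ->
  unitary x -> unitary t -> unitary (t *m y) -> codimfix t = 1%N ->
  codimfix (x *m t) = codimfix x -> codimfix (t *m y) = codimfix y ->
  codimfix (x *m (t *m y)) <> (codimfix x + codimfix (t *m y))%N.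
Proof.
move=> ux ut uy Ux Ut Uty t1 ext ety /mov_disjoint cap0.
have uty : t *m y \in unitmx by rewrite unitmx_mul ut uy.
have sx := reflection_mov_sub ux ut Ux Ut t1 ext.
have uinv : unitary (invmx (t *m y)).
  by rewrite /unitary invmxK Uty; apply/matrixP=> i j; rewrite !mxE conjCK.
(* Inversion moves the factor [t] to the right: the inverse of ty times t is the inverse of y, and
   inverses share moved spaces. *)
have sy : (t - 1%:M <= t *m y - 1%:M)%MS.
  rewrite -(mov_inv uty); apply: reflection_mov_sub => //.
    by rewrite unitmx_inv.
  have -> : invmx (t *m y) *m t = invmx y.
    by apply: (can_inj (mulKmx uty)); rewrite mulKVmx // mulmxK.
  by rewrite !codimfix_inv.
have : (t - 1%:M <= (x - 1%:M) :&: (t *m y - 1%:M))%MS by rewrite sub_capmx sx.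
by rewrite cap0 submx0 -mxrank_eq0 -codimfixE t1.
Qed.
End CodimFix.

(** * Cycles of a permutation times a transposition *)

Section Porbits.
Variable T : finType.
Implicit Types (s : {perm T}) (D : {set T}).

Lemma porbit_sub s D x :
  (forall y, y \in D -> s y \in D) -> x \in D -> porbit s x \subset D.
Proof.
move=> sD xD; apply/subsetP => _ /porbitP[i ->].
by elim: i => [|i IH]; rewrite ?perm1 // expgSr permM sD.
Qed.

Lemma perm_porbit s x y : (s y \in porbit s x) = (y \in porbit s x).
Proof.
rewrite -!eq_porbit_mem; congr (_ == _).
by rewrite -[s y]/((s ^+ 1)%g y) porbit_perm.
Qed.

Lemma porbits_partition s : partition (porbits s) setT.
Proof.
apply/and3P; split.
- apply/eqP/setP => x; rewrite inE; apply/bigcupP.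
  by exists (porbit s x); rewrite ?porbit_id ?imset_f.
- apply/trivIsetP => _ _ /imsetP[x _ ->] /imsetP[y _ ->].
  apply: contraR => /pred0Pn[z /andP[/=]].
  by rewrite -!eq_porbit_mem => /eqP <- /eqP <-.
- by apply/imsetP => -[x _ e]; have := porbit_id s x; rewrite -e inE.
Qed.

Lemma porbitsP s D x : D \in porbits s -> x \in D -> D = porbit s x.
Proof. by case/imsetP => y _ ->; rewrite -eq_porbit_mem => /eqP. Qed.

Lemma porbits_closed s D x : D \in porbits s -> (s x \in D) = (x \in D).
Proof. by case/imsetP => y _ ->; rewrite perm_porbit. Qed.

(** Multiplying by [tperm x y] adds or removes one cycle according to whether x and y share a cycle.
    Multiplying twice restores the count, so the two cases alternate. *)
Lemma mem_porbit_tperm s x y : x != y ->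
  (y \in porbit (tperm x y * s)%g x) = (y \notin porbit s x).
Proof.
move=> xy.
have := porbits_mul_tperm s x y; have := porbits_mul_tperm (tperm x y * s)%g x y.
rewrite /= tpermKg xy !(porbit_sym _ x y).
by case: (y \in _); case: (y \in _) => //=; lia.
Qed.

(** Since x and y share an orbit of the product, that orbit is stable under [s]; conversely the
    union of the two old orbits is stable under the product. *)
Lemma porbit_merge s x y : y \notin porbit s x ->
  porbit (tperm x y * s)%g x = porbit s x :|: porbit s y.
Proof.
move=> nxy; set s' := (tperm x y * s)%g.
have xy : x != y by apply: contraNneq nxy => <-; exact: porbit_id.
have ys' : y \in porbit s' x by rewrite mem_porbit_tperm.
have xs' := porbit_id s' x.
have closed_s z : z \in porbit s' x -> s z \in porbit s' x.
  move=> zs'; have -> : s z = s' (tperm x y z) by rewrite permM tpermK.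
  by rewrite perm_porbit; case: tpermP.
apply/eqP; rewrite eqEsubset subUset; apply/and3P.
split; apply: porbit_sub => //; last by rewrite inE porbit_id.
move=> z; rewrite permM !inE !perm_porbit.
by case: tpermP => // ->; rewrite ?porbit_id ?orbT.
Qed.

Lemma eq_porbit_in s s' x :
  (forall y, y \in porbit s x -> s' y = s y) -> porbit s' x = porbit s x.
Proof.
move=> e; have h i : (s' ^+ i)%g x = (s ^+ i)%g x.
  by elim: i => [|i IH]; rewrite ?perm1 // !expgSr !permM IH e ?mem_porbit.
by apply/setP=> y; apply/porbitP/porbitP => -[i ->]; exists i; rewrite h.
Qed.

Lemma porbits_merge s x y : y \notin porbit s x ->
  porbits (tperm x y * s)%g =
  (porbit s x :|: porbit s y) |: (porbits s :\ porbit s x :\ porbit s y).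
Proof.
move=> nxy; set s' := (tperm x y * s)%g.
have out z : z \notin porbit s x -> z \notin porbit s y ->
    porbit s' z = porbit s z.
  move=> zx zy; apply: eq_porbit_in => u uz; rewrite permM tpermD //.
    by apply: contraNneq zx => ->; rewrite porbit_sym.
  by apply: contraNneq zy => ->; rewrite porbit_sym.
have mx_ : porbit s' x = porbit s x :|: porbit s y by exact: porbit_merge.
apply/setP => D; rewrite !inE; apply/imsetP/orP.
  move=> [z _ ->].
  have [zx|zx] := boolP (z \in porbit s x).
    left; rewrite -mx_ eq_porbit_mem mx_ inE zx //.
  have [zy|zy] := boolP (z \in porbit s y).
    left; rewrite -mx_ eq_porbit_mem mx_ inE zy orbT //.
  by right; rewrite out // !eq_porbit_mem zx zy imset_f.
case=> [/eqP ->|/and3P[Dy Dx /imsetP[z _ Dz]]]; first by exists x.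
exists z => //; rewrite out //; rewrite -eq_porbit_mem -Dz //.
Qed.

(** The count makes [porbit s] injective, while x and s x have the same orbit. *)
Lemma card_porbits_perm1 s : #|porbits s| = #|T| -> s = 1%g.
Proof.
move=> c; have /imset_injP inj : #|porbit s @: [set: T]| == #|[set: T]|.
  rewrite cardsT -c; apply/eqP; congr #|pred_of_set _|.
  by apply/setP=> D; apply/imsetP/imsetP => -[x _ ->]; exists x.
apply/permP => x; rewrite perm1; apply: inj; rewrite ?inE //.
by apply/eqP; rewrite eq_porbit_mem perm_porbit porbit_id.
Qed.

Lemma card_porbits_le s : (#|porbits s| <= #|T|)%N.
Proof. exact: leq_imset_card. Qed.

Lemma porbit1 x : porbit (1 : {perm T})%g x = [set x].
Proof.
apply/setP=> y; rewrite inE; apply/porbitP/eqP => [[i ->]|->].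
  by rewrite expg1n perm1.
by exists 0%N; rewrite perm1.
Qed.

Lemma porbits1 : porbits (1 : {perm T})%g = set1 @: [set: T].
Proof.
by apply/setP=> D; apply/imsetP/imsetP => -[x _ ->]; exists x; rewrite ?porbit1 ?inE.
Qed.
End Porbits.

(** * Group structure and cycle weights *)

Section Elements.
Variables m' n : nat.
Notation m := m'.+1.
Notation elt := (elt m n).
Implicit Types (x y t : elt) (a : {ffun 'I_n -> 'I_m}) (v : 'I_m) (I : {set 'I_n}).

(** Permutations compose from left to right, so [y.1 * x.1] applies [y] first, as the product
    [mx x *m mx y] does on columns. With [m] a successor, ['I_m] is the additive group Z/m. *)
Definition emul x y : elt := ((y.1 * x.1)%g, [ffun i => y.2 i + x.2 (y.1 i)]).
Definition eone : elt := (1%g, [ffun => 0]).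
Definition einv x : elt := ((x.1^-1)%g, [ffun i => - x.2 ((x.1^-1)%g i)]).

Lemma emulA x y z : emul x (emul y z) = emul (emul x y) z.
Proof.
congr pair; first by rewrite /= mulgA.
by apply/ffunP=> i; rewrite !ffunE /= permM addrA.
Qed.

Lemma emul1 x : emul x eone = x.
Proof.
case: x => u a; congr pair; first by rewrite /= mul1g.
by apply/ffunP=> i; rewrite !ffunE /= perm1 add0r.
Qed.

Lemma e1mul x : emul eone x = x.
Proof.
case: x => u a; congr pair; first by rewrite /= mulg1.
by apply/ffunP=> i; rewrite !ffunE /= addr0.
Qed.

Lemma emulV x : emul x (einv x) = eone.
Proof.
congr pair; first by rewrite /= mulVg.
by apply/ffunP=> i; rewrite !ffunE /= addNr.
Qed.

Lemma eVmul x : emul (einv x) x = eone.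
Proof.
congr pair; first by rewrite /= mulgV.
by apply/ffunP=> i; rewrite !ffunE /= permK subrr.
Qed.

Lemma einvK x : einv (einv x) = x.
Proof. by rewrite -[LHS]e1mul -(emulV x) -emulA emulV emul1. Qed.

Lemma emulK x y : emul (emul x y) (einv y) = x.
Proof. by rewrite -emulA emulV emul1. Qed.

Lemma emulVK x y : emul (emul x (einv y)) y = x.
Proof. by rewrite -emulA eVmul emul1. Qed.

Lemma zetaD (u v : 'I_m) : zeta m ^+ (u + v)%R = zeta m ^+ u * zeta m ^+ v.
Proof. by rewrite /= (prim_expr_mod (prim_zeta (ltn0Sn m'))) exprD. Qed.

Lemma zeta_eq1 v : (zeta m ^+ v == 1) = (v == 0).
Proof. by rewrite -(prim_order_dvd (prim_zeta (ltn0Sn m'))) /dvdn modn_small. Qed.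

Lemma zeta_neq0 : zeta m != 0.
Proof. by rewrite (prim_root_eq0 (prim_zeta (ltn0Sn m'))). Qed.

Lemma mx_mul x y : mx (emul x y) = mx x *m mx y.
Proof.
apply/matrixP=> i j; rewrite !mxE (bigD1 (y.1 j)) //= !mxE eqxx permM.
rewrite big1 => [|k /negbTE kj]; last by rewrite !mxE kj mulr0.
by rewrite addr0 ffunE zetaD mulrC; case: eqP; rewrite ?mul0r ?mulr0.
Qed.

Lemma mx_one : mx eone = 1%:M.
Proof. by apply/matrixP=> i j; rewrite !mxE perm1 ffunE /=; case: eqP. Qed.

Lemma mx_inj : injective (@mx m n).
Proof.
move=> x y /matrixP e.
have e1 i : x.1 i = y.1 i.
  have := e (x.1 i) i; rewrite !mxE eqxx; case: eqP => // _ /eqP.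
  by rewrite expf_eq0 (negbTE zeta_neq0) andbF.
rewrite [x]surjective_pairing [y]surjective_pairing; congr pair.
  exact/permP.
apply/ffunP=> i; have := e (x.1 i) i; rewrite !mxE e1 eqxx => /eqP.
by rewrite (eq_prim_root_expr (prim_zeta (ltn0Sn m'))) !modn_small // => /eqP/val_inj.
Qed.

Lemma mx_unit x : mx x \in unitmx.
Proof.
have e : mx x *m mx (einv x) = 1%:M by rewrite -mx_mul emulV mx_one.
by have [] := mulmx1_unit e.
Qed.

Lemma mx_inv x : invmx (mx x) = mx (einv x).
Proof.
apply: (can_inj (mulKmx (mx_unit x))).
by rewrite mulmxV ?mx_unit // -mx_mul emulV mx_one.
Qed.

Lemma mx_unitary x : unitary (mx x).
Proof.
rewrite /unitary mx_inv; apply/matrixP=> i j; rewrite !mxE /= ffunE.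
rewrite -[i == _](inj_eq (@perm_inj _ x.1)) permKV [j == _]eq_sym.
case: eqP => [<-|_]; last by rewrite rmorph0.
rewrite permK; apply: (@mulfI _ (zeta m ^+ x.2 i)).
  by rewrite expf_eq0 (negbTE zeta_neq0) andbF.
rewrite -zetaD subrr expr0 -normCK normrX.
have -> : `|zeta m| = 1.
  apply/eqP; rewrite -(@pexpr_eq1 _ _ m) ?normr_ge0 // -normrX.
  by rewrite (prim_expr_order (prim_zeta (ltn0Sn m'))) normr1.
by rewrite !expr1n.
Qed.

Definition wz a I : 'I_m := \sum_(i in I) a i.

Lemma wtsetE a I : wtset a I = wz a I :> nat.
Proof.
rewrite /wtset /wz; elim/big_rec2: _ => [|i y1 y2 _ IH]; first by rewrite mod0n.
by rewrite /= -modnDmr IH.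
Qed.

Lemma wz_emul x t I : (forall i, (t.1 i \in I) = (i \in I)) ->
  wz (emul x t).2 I = wz t.2 I + wz x.2 I.
Proof.
move=> tI; rewrite /wz (eq_bigr _ (fun i _ => ffunE _ i)) big_split /=.
congr (_ + _); rewrite [RHS](reindex_inj (@perm_inj _ t.1)) /=.
by apply: eq_bigl => i; rewrite tI.
Qed.

Definition ncyc x v : nat := \sum_(C in cycles x) (wz x.2 C == v).

Lemma ncyc_le x v : (ncyc x v <= #|cycles x|)%N.
Proof. by rewrite -sum1_card leq_sum // => C _; case: eqP. Qed.

Lemma ncyc_len x v : (ncyc x v <= n)%N.
Proof.
by apply: leq_trans (ncyc_le x v) (leq_trans (card_porbits_le x.1) _); rewrite card_ord.
Qed.

Lemma ncyc_one v : ncyc eone v = if v == 0 then n else 0%N.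
Proof.
rewrite /ncyc; have -> : cycles eone = set1 @: [set: 'I_n] by exact: porbits1.
rewrite big_imset /=; last by move=> i j _ _ /set1_inj.
rewrite (eq_bigr (fun=> nat_of_bool (v == 0))) => [|i _]; last first.
  by rewrite /wz big_set1 ffunE eq_sym.
by rewrite sum_nat_const cardsT card_ord; case: eqP; rewrite ?muln1 ?muln0.
Qed.

Lemma ncyc0_one x : ncyc x 0 = n -> x = eone.
Proof.
move=> e; have u1 : x.1 = 1%g.
  apply: card_porbits_perm1; apply/eqP; rewrite eqn_leq card_porbits_le card_ord /=.
  by rewrite -{1}e ncyc_le.
rewrite [x]surjective_pairing u1; congr pair; apply/ffunP=> i; rewrite ffunE.
apply/eqP; apply: contraT => xi; suff : (ncyc x 0%R < n)%N by rewrite e ltnn.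
rewrite /ncyc; have -> : cycles x = set1 @: [set: 'I_n] by rewrite /cycles u1 porbits1.
rewrite big_imset /=; last by move=> ? ? _ _ /set1_inj.
rewrite (bigD1 i (in_setT i)) /= /wz big_set1 (negbTE xi) add0n.
apply: (@leq_ltn_trans (\sum_(j | (j \in setT) && (j != i)) 1)).
  by apply: leq_sum => j _; case: eqP.
rewrite sum1_card; apply: (@leq_trans #|[set: 'I_n]|); last by rewrite cardsT card_ord.
apply: proper_card; apply/properP; split; last first.
  by exists i; rewrite ?in_setT // unfold_in /= eqxx andbF.
by apply/subsetP => j _; rewrite inE.
Qed.

(** The opposite weights at distinct [i] and [j] make this an involution of total weight 0, so it
    lies in every G(m,p,n). *)
Definition eswap (i j : 'I_n) (d : 'I_m) : elt :=
  (tperm i j, [ffun k => if k == i then d else if k == j then - d else 0]).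
Definition ediag (i : 'I_n) (d : 'I_m) : elt :=
  (1%g, [ffun k => if k == i then d else 0]).

Lemma wz_eswap i j d I : (i \in I) = (j \in I) -> i != j -> wz (eswap i j d).2 I = 0.
Proof.
move=> eI nij; have [iI|iI] := boolP (i \in I); last first.
  apply: big1 => k kI; rewrite ffunE.
  have -> : k == i = false by apply: contraNF iI => /eqP <-.
  by have -> : k == j = false by apply: contraNF iI => /eqP; rewrite eI => <-.
rewrite /wz (bigD1 i) //= (bigD1 j) /=; last by rewrite -eI iI eq_sym.
rewrite big1 => [|k /andP[/andP[_ /negbTE ki] /negbTE kj]]; last by rewrite ffunE ki kj.
by rewrite !ffunE !eqxx eq_sym (negbTE nij) addr0 subrr.
Qed.

Lemma wz_ediag i d I : wz (ediag i d).2 I = if i \in I then d else 0.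
Proof.
case: ifP => iI; last first.
  by apply: big1 => k kI; rewrite ffunE; case: eqP => // ki; rewrite -ki kI in iI.
rewrite /wz (bigD1 i) //= big1 => [|k /andP[_ /negbTE ki]]; last by rewrite ffunE ki.
by rewrite ffunE eqxx addr0.
Qed.

Lemma wzU a I (J : {set 'I_n}) : [disjoint I & J] -> wz a (I :|: J) = wz a I + wz a J.
Proof. by move=> d; rewrite /wz -bigU //=; apply: eq_bigl => i; rewrite !inE. Qed.

(** A set containing both or neither of [i] and [j] has weight 0 in [eswap i j d]. Hence the
    untouched cycles keep their weights and the merged cycle gets the sum of two. *)
Lemma ncyc_merge x i j d v : j \notin porbit x.1 i ->
  (ncyc (emul x (eswap i j d)) v + (wz x.2 (porbit x.1 i) == v)
     + (wz x.2 (porbit x.1 j) == v) =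
   ncyc x v + (wz x.2 (porbit x.1 i) + wz x.2 (porbit x.1 j) == v)%R)%N.
Proof.
move=> nij; have ij : i != j by apply: contraNneq nij => <-; exact: porbit_id.
set C := porbit x.1 i; set C' := porbit x.1 j.
have CC' : C != C' by rewrite eq_sym eq_porbit_mem.
have tinv (I : {set 'I_n}) : (i \in I) = (j \in I) ->
    forall k, ((eswap i j d).1 k \in I) = (k \in I).
  by move=> e k /=; case: tpermP => // ->.
have wE (I : {set 'I_n}) : (i \in I) = (j \in I) ->
    wz (emul x (eswap i j d)).2 I = wz x.2 I.
  by move=> e; rewrite wz_emul ?wz_eswap ?add0r //; exact: tinv.
rewrite {1}/ncyc /cycles /= porbits_merge // -/C -/C'.
rewrite big_setU1 /=; last first.
  rewrite !inE; apply/and3P => -[_ /eqP nC /porbitsP/(_ (_ : i \in _)) e].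
  by apply: nC; rewrite -/C e // inE porbit_id.
rewrite wE ?inE ?porbit_id ?orbT // wzU; last first.
  apply/pred0Pn => -[k /andP[/=]]; rewrite -!eq_porbit_mem => /eqP -> /eqP e.
  by move/eqP: CC'; apply.
rewrite (eq_bigr (fun D => nat_of_bool (wz x.2 D == v))) => [|D]; last first.
  rewrite !inE => /and3P[DC' DC Dx]; rewrite wE //.
  apply/idP/idP => kD; last by move: DC'; rewrite (porbitsP Dx kD) eqxx.
  by move: DC; rewrite (porbitsP Dx kD) eqxx.
rewrite {1}/ncyc [X in _ = (X + _)%N](big_setD1 C) /=; last exact: imset_f.
rewrite [X in _ = (_ + X + _)%N](big_setD1 C') /=; last first.
  by rewrite !inE eq_sym CC'; exact: imset_f.
rewrite /cycles; move: (\sum_(D in _) _)%N.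
by move: (nat_of_bool _) (nat_of_bool _) (nat_of_bool _) => *; lia.
Qed.

Lemma ncyc_diag x i d v :
  (ncyc (emul x (ediag i d)) v + (wz x.2 (porbit x.1 i) == v) =
   ncyc x v + (wz x.2 (porbit x.1 i) + d == v)%R)%N.
Proof.
have wE (I : {set 'I_n}) :
    wz (emul x (ediag i d)).2 I = (if i \in I then d else 0) + wz x.2 I.
  by rewrite wz_emul ?wz_ediag // => k; rewrite perm1.
rewrite /ncyc /cycles /= mul1g (big_setD1 (porbit x.1 i)) /=; last by rewrite imset_f.
rewrite wE porbit_id [d + _]addrC.
rewrite (eq_bigr (fun D => nat_of_bool (wz x.2 D == v))) => [|D]; last first.
  rewrite !inE => /andP[Di Dx]; rewrite wE; case: ifP => [iD|_]; last by rewrite add0r.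
  by move: Di; rewrite (porbitsP Dx iD) eqxx.
rewrite [X in _ = (X + _)%N](big_setD1 (porbit x.1 i)) /=; last exact: imset_f.
by move: (\sum_(D in _) _)%N (nat_of_bool _) (nat_of_bool _) => *; lia.
Qed.
End Elements.

(** * Reflections and fixed spaces *)

Section Reflections.
Variables m' n : nat.
Notation m := m'.+1.
Notation elt := (elt m n).
Implicit Types (p : nat) (x y t : elt) (v : 'I_m).

(** A fixed row satisfies r_c = zeta^(a_c) r_(u(c)). Iterating around a whole cycle multiplies by
    zeta to the weight of that cycle. *)
Lemma mx_fix_iter x (r : 'rV[algC]_n) c k : r *m mx x = r ->
  r 0 c = zeta m ^+ (\sum_(0 <= j < k) x.2 (iter j x.1 c))%R * r 0 (iter k x.1 c).
Proof.
move=> fx; have step i : r 0 i = zeta m ^+ x.2 i * r 0 (x.1 i).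
  rewrite -{1}fx !mxE (bigD1 (x.1 i)) //= !mxE eqxx big1 ?addr0 1?mulrC // => j ji.
  by rewrite !mxE (negbTE ji) mulr0.
elim: k => [|k IH]; first by rewrite big_geq // expr0 mul1r.
by rewrite big_nat_recr //= zetaD -mulrA -step -IH.
Qed.

Lemma wz_porbit x c :
  wz x.2 (porbit x.1 c) = \sum_(0 <= j < #|porbit x.1 c|) x.2 (iter j x.1 c).
Proof.
rewrite /wz (eq_bigl (mem (traject x.1 c #|porbit x.1 c|))); last first.
  by move=> i; rewrite /= porbit_traject.
rewrite -big_uniq ?uniq_traject_porbit // (big_nth c) size_traject.
by apply: eq_big_nat => j /andP[_ jk]; rewrite nth_traject.
Qed.

(* A fixed row vector vanishes on cycles of nonzero weight and is determined by
   its value at one point of every other cycle. *)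
Lemma codimfix_mx_ge x : (n - ncyc x 0%R <= codimfix (mx x))%N.
Proof.
pose Z := [set C in cycles x | wz x.2 C == 0].
have cZ : ncyc x 0%R = #|Z|.
  rewrite -sum1_card /ncyc big_mkcond [RHS]big_mkcond /=; apply: eq_bigr => C _.
  by rewrite inE; case: (C \in _); case: eqP.
pose rep (C : {set 'I_n}) := [pick z in C].
(* Right multiplication by [E] evaluates a row at the chosen representatives of the weight-0 cycles;
   injectivity on the fixed space bounds its dimension by their number. *)
pose E : 'M[algC]_(n, #|Z|) :=
  \matrix_(i, k) (Some i == rep (enum_val k))%:R.
rewrite codimfixE leq_subLR addnC -leq_subLR -mxrank_ker cZ.
have -> : \rank (kermx (mx x - 1%:M)) = \rank (kermx (mx x - 1%:M) *m E).
  apply/esym/mxrank_injP; rewrite -submx0; apply/rV_subP => r.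
  rewrite sub_capmx => /andP[/sub_kermxP rx /sub_kermxP rE].
  have {}rx : r *m mx x = r.
    by apply/eqP; rewrite -subr_eq0 -[X in _ - X]mulmx1 -mulmxBr rx.
  suff -> : r = 0 by rewrite sub0mx.
  apply/rowP => c; rewrite mxE; apply/eqP; apply: contraT => rc.
  pose D := porbit x.1 c.
  have DZ : D \in Z.
    rewrite inE imset_f //= -zeta_eq1 wz_porbit.
    apply/eqP/(mulIf rc); rewrite mul1r {2}(mx_fix_iter c #|D| rx).
    by rewrite [iter _ _ _]iter_porbit.
  have [z zD repD] : exists2 z, z \in D & rep D = Some z.
    by rewrite /rep; case: pickP => [z zD|/(_ c)]; [exists z | rewrite porbit_id].
  have /rowP/(_ (enum_rank_in DZ D)) := rE; rewrite !mxE.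
  rewrite (bigD1 z) //= mxE enum_rankK_in // repD eqxx mulr1.
  rewrite big1 ?addr0 => [rz|i iz]; last first.
    by rewrite mxE enum_rankK_in // repD (inj_eq Some_inj) (negbTE iz) mulr0.
  have /porbitP[k zk] := zD; move: rc; rewrite (mx_fix_iter c k rx).
  by rewrite -permX -zk rz mulr0 eqxx.
exact: rank_leq_col.
Qed.

Definition pdvd p v := (p %| v)%N.

Lemma pdvd0 p : pdvd p 0.
Proof. exact: dvdn0. Qed.

Lemma pdvdD p u v : (p %| m)%N -> pdvd p u -> pdvd p (u + v) = pdvd p v.
Proof.
move=> pm pu; rewrite /pdvd /= /dvdn modn_dvdm //.
by rewrite -[_ == _]/(p %| _)%N dvdn_addr.
Qed.

Lemma pdvdN p v : (p %| m)%N -> pdvd p (- v) = pdvd p v.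
Proof.
move=> pm; apply/idP/idP => h; last by rewrite -(pdvdD (- v) pm h) subrr pdvd0.
by rewrite -(pdvdD v pm h) addNr pdvd0.
Qed.

Lemma inGE p x : (p %| m)%N -> inG p x = pdvd p (wz x.2 setT).
Proof. by move=> pm; rewrite /inG /wt wtsetE. Qed.

(** The explicit list of reflections of G(m,p,n); [is_reflectionP] identifies it with the geometric
    definition. *)
Definition refl_type p t :=
  (exists i j d, i != j /\ t = eswap i j d) \/
  (exists i d, [/\ d != 0, pdvd p d & t = ediag i d]).

(* The multiset of weights with multiplicities [N] splits, away from the
   weights divisible by [p], into pairs of opposite weights. *)
Definition paired p (N : 'I_m -> nat) :=
  forall v, ~~ pdvd p v -> N v = N (- v) /\ (v = - v -> ~~ odd (N v)).

Lemma eswapV i j d : i != j -> einv (eswap i j d : elt) = eswap i j d.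
Proof.
move=> ij; congr pair; first by rewrite /= tpermV.
apply/ffunP=> k; rewrite !ffunE /= tpermV; case: tpermP => [->|->|].
- by rewrite eq_sym (negbTE ij) eqxx eqxx opprK.
- by rewrite eqxx eq_sym (negbTE ij) eqxx.
by move=> /eqP/negbTE -> /eqP/negbTE ->; rewrite oppr0.
Qed.

Lemma ediagV i d : einv (ediag i d : elt) = ediag i (- d).
Proof.
congr pair; first by rewrite /= invg1.
by apply/ffunP=> k; rewrite !ffunE /= invg1 perm1; case: eqP; rewrite ?oppr0.
Qed.

Lemma wz_id1 x i : x.1 = 1%g -> wz x.2 (porbit x.1 i) = x.2 i.
Proof. by move=> ->; rewrite porbit1 /wz big_set1. Qed.

Lemma ncyc_id1 x v : x.1 = 1%g -> ncyc x v = (\sum_i (x.2 i == v))%N.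
Proof.
move=> x1; rewrite /ncyc; have -> : cycles x = set1 @: [set: 'I_n].
  by rewrite /cycles x1 porbits1.
rewrite big_imset /=; last by move=> ? ? _ _ /set1_inj.
by apply: eq_big => [i|i _]; rewrite ?inE // /wz big_set1.
Qed.

(** If the permutation is nontrivial, a fixed point of weight 0 can be split off. If it is trivial,
    some weight is nonzero: it is cancelled when divisible by [p], and otherwise pairedness supplies
    an opposite weight to merge with. *)
Lemma exists_reflection p x : (p %| m)%N -> paired p (ncyc x) -> x != eone m' n ->
  exists2 t, refl_type p t & ncyc (emul x t) 0 = (ncyc x 0).+1.
Proof.
move=> pm Qx nx; have [x1|x1] := eqVneq x.1 1%g; last first.
  have [k xk] : exists k, x.1 k != k.
    apply/existsP; apply: contraNT x1 => /existsPn h; apply/eqP/permP => k.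
    by rewrite perm1; apply/eqP; have := h k; rewrite negbK.
  pose l := (x.1^-1)%g k.
  have kl : k != l by rewrite -(inj_eq (@perm_inj _ x.1)) permKV.
  (* The product [y] sends k to l and back to k, and the weight of [t] at k cancels that of [x] at
     l. Then [x] is recovered from [y] by a merge. *)
  pose t := eswap k l (- x.2 l) : elt; pose y := emul x t.
  exists t; first by left; exists k, l, (- x.2 l).
  have xE : emul y t = x by rewrite -[t in emul _ t](eswapV _ kl) emulK.
  have yk : porbit y.1 k = [set k].
    apply/eqP; rewrite eqEsubset sub1set porbit_id andbT porbit_sub ?set11 // => i.
    by rewrite !inE => /eqP ->; rewrite permM /= tpermL permKV.
  have wyk : wz y.2 (porbit y.1 k) = 0.
    by rewrite yk /wz big_set1 ffunE /= ffunE eqxx tpermL addNr.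
  have := @ncyc_merge _ _ y k l (- x.2 l) 0; rewrite -/t xE wyk eqxx add0r.
  rewrite yk inE eq_sym kl => /(_ isT); rewrite -[emul x t]/y.
  by move=> /addIn <-; rewrite addn1.
have [i xi] : exists i, x.2 i != 0.
  apply/existsP; apply: contraNT nx => /existsPn h; apply/eqP.
  rewrite [x]surjective_pairing x1; congr pair; apply/ffunP => k.
  by rewrite ffunE; apply/eqP; have := h k; rewrite negbK.
have [pi|pi] := boolP (pdvd p (x.2 i)).
  exists (ediag i (- x.2 i)).
    by right; exists i, (- x.2 i); rewrite oppr_eq0 pdvdN.
  have := ncyc_diag x i (- x.2 i) 0.
  by rewrite wz_id1 // (negbTE xi) subrr eqxx; lia.
have [j ji xj] : exists2 j, j != i & x.2 j = - x.2 i.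
  have [/existsP[j /andP[ji /eqP xj]]|/existsPn h] :=
    boolP [exists j, (j != i) && (x.2 j == - x.2 i)]; first by exists j.
  (* Without a partner, only [i] itself can carry the opposite weight: then either the two
     multiplicities differ, or a self-opposite weight has multiplicity one. *)
  have N0 : ncyc x (- x.2 i) = (x.2 i == - x.2 i) :> nat.
    rewrite ncyc_id1 // (bigD1 i) //= big1 ?addn0 // => k ki.
    by have := h k; rewrite ki /=; case: eqP.
  have Ni : (0 < ncyc x (x.2 i))%N by rewrite ncyc_id1 // (bigD1 i) //= eqxx.
  have [e1 e2] := Qx _ pi; move: N0 e2 Ni; rewrite -e1.
  by case: eqP => [e -> /(_ e)|_ ->].
have nij : j \notin porbit x.1 i by rewrite x1 porbit1 inE.
exists (eswap i j 0); first by left; exists i, j, 0; rewrite eq_sym ji.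
have := ncyc_merge 0 0 nij.
by rewrite !wz_id1 // xj subrr eqxx oppr_eq0 (negbTE xi); lia.
Qed.

Lemma refl_typeV p t : (p %| m)%N -> refl_type p t -> refl_type p (einv t).
Proof.
move=> pm [[i [j [d [ij ->]]]]|[i [d [d0 pd ->]]]].
  by left; exists i, j, d; rewrite eswapV.
by right; exists i, (- d); rewrite ediagV oppr_eq0 pdvdN.
Qed.

(** In both cases t - 1 is an explicit column times a row. *)
Lemma refl_type_codim_le p t : refl_type p t -> (codimfix (mx t) <= 1)%N.
Proof.
have rk1 (A : 'cV[algC]_n) (B : 'rV[algC]_n) : mx t - 1%:M = A *m B ->
    (codimfix (mx t) <= 1)%N.
  rewrite codimfixE => ->; apply: leq_trans (mxrankM_maxl _ _) _.
  exact: rank_leq_col.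
case=> [[i [j [d [ij te]]]]|[i [d [_ _ te]]]]; rewrite te in rk1 *.
  apply: (rk1 (\col_k (if k == i then 1 else if k == j then - zeta m ^+ d else 0))
    (\row_k (if k == i then - 1 else if k == j then zeta m ^+ (- d)%R else 0))).
  have ji : j == i = false by rewrite eq_sym (negbTE ij).
  have zz : zeta m ^+ d * zeta m ^+ (- d)%R = 1 by rewrite -zetaD subrr expr0.
  apply/matrixP=> r c; rewrite !mxE big_ord1 !mxE /= ffunE.
  case: tpermP => [->|->|/eqP/negbTE -> /eqP/negbTE ->].
  - rewrite eqxx; have [->|rj] := eqVneq r j; first by rewrite ji subr0; ring.
    by case: eqP; rewrite ?mulr0n ?mulr1n ?sub0r ?oppr0 ?mul0r ?mul1r.
  - rewrite ji eqxx; have [->|ri] := eqVneq r i.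
      by rewrite (negbTE ij) subr0 mul1r.
    by case: eqP; rewrite ?mulr0n ?mulr1n ?mulNr ?zz ?sub0r ?mul0r ?subr0 ?oppr0.
  by rewrite mulr0 expr0; case: eqP; rewrite subrr.
apply: (rk1 (\col_k (k == i)%:R) (\row_k (if k == i then zeta m ^+ d - 1 else 0))).
apply/matrixP=> r c; rewrite !mxE big_ord1 !mxE /= perm1 ffunE.
have [->|ci] := eqVneq c i; first by case: eqP; rewrite ?mul1r ?mul0r ?subr0.
by rewrite mulr0 expr0; case: eqP; rewrite subrr.
Qed.

Lemma prodmx_rcons (s : seq elt) t : prodmx (rcons s t) = prodmx s *m mx t.
Proof. by elim: s => [|r s IH] /=; rewrite ?mul1mx ?mulmx1 // IH mulmxA. Qed.

Lemma prodmx_cat (s1 s2 : seq elt) : prodmx (s1 ++ s2) = prodmx s1 *m prodmx s2.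
Proof. by elim: s1 => [|r s IH] /=; rewrite ?mul1mx // IH mulmxA. Qed.
End Reflections.

(** * Effect of a reflection on cycle weights *)

Section Length.
Variables m' n : nat.
Notation m := m'.+1.
Notation elt := (elt m n).
Implicit Types (p : nat) (x y t : elt) (v : 'I_m).

(** The cases are a merge, a split and a weight shift. A split is a merge read backwards, since
    [eswap] is its own inverse. *)
Lemma ncyc_step p x t (N := ncyc x) (N' := ncyc (emul x t)) : refl_type p t ->
  [\/ exists b c, forall v, (N' v + (b == v) + (c == v) = N v + (b + c == v)%R)%N,
      exists b c, forall v, (N v + (b == v) + (c == v) = N' v + (b + c == v)%R)%N
    | exists c d, pdvd p d /\
        forall v, (N' v + (c == v) = N v + (c + d == v)%R)%N].
Proof.
case=> [[i [j [d [ij te]]]]|[i [d [d0 pd te]]]]; rewrite /N /N' te; last first.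
  by apply: Or33; exists (wz x.2 (porbit x.1 i)), d; split=> // v; apply: ncyc_diag.
have [xij|nij] := boolP (j \in porbit x.1 i); last first.
  apply: Or31; exists (wz x.2 (porbit x.1 i)), (wz x.2 (porbit x.1 j)) => v.
  exact: ncyc_merge.
set y := emul x _; have yx : emul y (eswap i j d) = x.
  by rewrite -{1}(eswapV d ij) /y emulK.
have nij : j \notin porbit y.1 i.
  by move: xij; rewrite -{1}yx /= mem_porbit_tperm.
apply: Or32; exists (wz y.2 (porbit y.1 i)), (wz y.2 (porbit y.1 j)) => v.
by have := ncyc_merge d v nij; rewrite yx.
Qed.

Lemma eq_paired p (N N' : 'I_m -> nat) : (p %| m)%N ->
  (forall v, ~~ pdvd p v -> N v = N' v) -> paired p N <-> paired p N'.
Proof.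
move=> pm e; suff imp (M M' : 'I_m -> nat) :
    (forall v, ~~ pdvd p v -> M v = M' v) -> paired p M -> paired p M'.
  by split; apply: imp => // v /e.
by move=> eM QM v pv; rewrite -!eM ?pdvdN //; exact: QM.
Qed.

(** The pair {b, -b} contributes equally to the multiplicities of v and -v, and contributes 0 or 2
    when v = -v. *)
Lemma paired_add_pair p (N N' : 'I_m -> nat) (b : 'I_m) : (p %| m)%N ->
  (forall v, v != 0 -> N v = (N' v + (b == v) + (- b == v)%R)%N) ->
  paired p N <-> paired p N'.
Proof.
move=> pm e.
have key v : ~~ pdvd p v -> exists2 k : nat,
    N v = (N' v + k)%N /\ N (- v) = (N' (- v)%R + k)%N & (v = - v -> ~~ odd k).
  move=> pv; exists ((b == v) + (- b == v)%R)%N.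
    split; first by rewrite addnA e //; apply: contraNneq pv => ->; exact: pdvd0.
    rewrite e; last first.
      by apply: contraNneq pv => /eqP; rewrite oppr_eq0 => /eqP ->; exact: pdvd0.
    rewrite eqr_opp [b == - v]eq_sym eqr_oppLR [v == _]eq_sym -addnA.
    by congr (_ + _)%N; rewrite addnC.
  by move=> vN; rewrite {2}vN eqr_opp; case: (b == v).
split=> Q v pv; have [k [e1 e2] ek] := key v pv; have [Q1 Q2] := Q v pv.
  split; first by apply/(@addIn k); rewrite -e1 -e2.
  by move=> vN; have := Q2 vN; rewrite e1 oddD (negbTE (ek vN)) addbF.
split; first by rewrite e1 e2 Q1.
by move=> vN; rewrite e1 oddD (negbTE (ek vN)) addbF Q2.
Qed.

(* Raising the number of weight-0 cycles can only merge an opposite pair,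
   split off a cycle of weight 0, or cancel a weight divisible by [p]. *)
Lemma ncyc_raise p x t : (p %| m)%N -> refl_type p t ->
  ncyc (emul x t) 0 = (ncyc x 0).+1 ->
  (forall v, v != 0 -> (ncyc (emul x t) v <= ncyc x v)%N) /\
  (paired p (ncyc (emul x t)) <-> paired p (ncyc x)).
Proof.
move=> pm rt e0; case: (ncyc_step x rt).
- move=> [b [c e]]; have := e 0; rewrite e0.
  have [bc|] := eqVneq (b + c) 0; last by move=> _; lia.
  have [//|b0] := eqVneq b 0; first by lia.
  have [//|c0 _] := eqVneq c 0; first by lia.
  have cE : c = - b by apply/eqP; rewrite -addr_eq0 addrC bc.
  have e' v : v != 0 -> ncyc x v = (ncyc (emul x t) v + (b == v) + (- b == v)%R)%N.
    by move=> v0; have := e v; rewrite bc cE [0 == v]eq_sym (negbTE v0) addn0.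
  split; first by move=> v /e' ->; rewrite -addnA leq_addr.
  by split=> Q; apply/(paired_add_pair pm e').
- move=> [b [c e]].
  (* The count at weight 0 forces one part of the split cycle to have weight 0, so the other part
     keeps the old weight. *)
  have e' v : v != 0 -> ncyc (emul x t) v = ncyc x v.
    move=> v0; have := e 0; have := e v; rewrite e0.
    have [->|b0] := eqVneq b 0.
      by rewrite add0r [0 == v]eq_sym (negbTE v0) addn0 => /addIn ->.
    have [->|c0] := eqVneq c 0; last by lia.
    by rewrite addr0 [0 == v]eq_sym (negbTE v0) addn0 => /addIn ->.
  split; first by move=> v /e' ->.
  apply: eq_paired => // v pv; apply: e'; apply: contraNneq pv => ->; exact: pdvd0.
- move=> [c [d [pd e]]]; have := e 0; rewrite e0.
  have [cd|] := eqVneq (c + d) 0; last by move=> _; lia.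
  move=> _; have pc : pdvd p c.
    by rewrite -(pdvdN _ pm) -(eqP (_ : d == - c)) // -addr_eq0 addrC cd.
  have e' v : v != 0 -> (ncyc (emul x t) v + (c == v))%N = ncyc x v.
    by move=> v0; rewrite e cd [0 == v]eq_sym (negbTE v0) addn0.
  split; first by move=> v /e' <-; rewrite leq_addr.
  apply: eq_paired => // v pv; rewrite -e'; last first.
    by apply: contraNneq pv => ->; exact: pdvd0.
  by have -> : c == v = false; [apply: contraNF pv => /eqP <- | rewrite addn0].
Qed.

(** Every weight is divisible by 1, so statements about paired elements specialize to all of
    G(m,1,n). *)
Lemma paired1 (N : 'I_m -> nat) : paired 1 N.
Proof. by move=> v; rewrite /pdvd dvd1n. Qed.

(** Right multiplication by the reflections of [exists_reflection] raises N(0) one at a time and, by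
    [ncyc_raise], keeps the element paired until the identity is reached. *)
Lemma refl_factorization p x : (p %| m)%N -> paired p (ncyc x) ->
  exists s : seq elt, [/\ forall t, t \in s -> refl_type p t,
    size s = (n - ncyc x 0%R)%N & prodmx s = mx x].
Proof.
move=> pm Qx; have [N] := ubnP (n - ncyc x 0%R)%N; elim: N x Qx => // N IH x Qx lt.
have [->|nx] := eqVneq x (eone m' n).
  by exists [::]; rewrite ncyc_one eqxx subnn mx_one.
have [t rt e] := exists_reflection pm Qx nx.
have lt0 := ncyc_len (emul x t) 0; rewrite e in lt0.
have [|s [rs ss ps]] := IH _ ((ncyc_raise pm rt e).2.2 Qx); first by rewrite e; lia.
exists (rcons s (einv t)); split.
- move=> u; rewrite mem_rcons inE => /orP[/eqP ->|/rs //]; exact: refl_typeV.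
- by rewrite size_rcons ss e; lia.
- by rewrite prodmx_rcons ps -mx_mul emulK.
Qed.

(** The upper bound is subadditivity along a factorization into n - N(0) reflections of G(m,1,n). *)
Lemma codimfix_mx x : codimfix (mx x) = (n - ncyc x 0%R)%N.
Proof.
apply/eqP; rewrite eqn_leq codimfix_mx_ge andbT.
have [s [rs <- <-]] := refl_factorization (dvd1n m) (paired1 (ncyc x)).
elim: s rs => [|t s IH] rs; first by rewrite /= codimfix1.
apply: leq_trans (codimfixM _ _) _; rewrite -[size _]/(1 + size s)%N leq_add //.
  by apply: refl_type_codim_le (rs t _); rewrite mem_head.
by apply: IH => u us; apply: rs; rewrite inE us orbT.
Qed.

Lemma codimfix_raise x y : codimfix (mx x) = (codimfix (mx y)).+1 ->
  ncyc y 0 = (ncyc x 0).+1.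
Proof. by rewrite !codimfix_mx; have := ncyc_len x 0; have := ncyc_len y 0; lia. Qed.

Lemma codimfix_unraise x y : ncyc y 0 = (ncyc x 0).+1 ->
  codimfix (mx x) = (codimfix (mx y)).+1.
Proof. by rewrite !codimfix_mx; have := ncyc_len x 0; have := ncyc_len y 0; lia. Qed.

Lemma inG_ediag p i d : (p %| m)%N -> inG p (ediag i d : elt) = pdvd p d.
Proof. by move=> pm; rewrite inGE // wz_ediag inE. Qed.

Lemma inG_mul p x y : (p %| m)%N -> inG p x -> inG p (emul x y) = inG p y.
Proof.
move=> pm; rewrite !inGE // wz_emul; last by move=> i; rewrite !inE.
by move=> px; rewrite addrC pdvdD.
Qed.

Lemma inG_one p : (p %| m)%N -> inG p (eone m' n).
Proof. by move=> pm; rewrite inGE // /wz big1 ?pdvd0 // => i _; rewrite ffunE. Qed.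

Lemma inG_inv p x : (p %| m)%N -> inG p x -> inG p (einv x).
Proof. by move=> pm px; rewrite -(inG_mul _ pm px) emulV inG_one. Qed.

(** An element of codimension 1 is one reflection of G(m,1,n) away from the identity, hence is the
    inverse of a listed one; membership in G(m,p,n) then gives divisibility of a diagonal weight. *)
Lemma is_reflectionP p t : (p %| m)%N ->
  is_reflection p t <-> refl_type p t.
Proof.
move=> pm; split.
  case/andP => Gt /eqP c1; have nt : t != eone m' n.
    by apply: contra_eq_neq c1 => ->; rewrite mx_one codimfix1.
  have [r rr e] := exists_reflection (dvd1n m) (paired1 (ncyc t)) nt.
  have tr : emul t r = eone m' n.
    by apply: ncyc0_one; have := codimfix_unraise e; rewrite c1 codimfix_mx;
       have := ncyc_len (emul t r) 0; lia.
  have te : t = einv r by rewrite -[t](emulK _ r) tr e1mul.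
  move: Gt; rewrite te; case: (refl_typeV (dvd1n m) rr); first by left.
  move=> [i [d [d0 _ ->]]]; rewrite inG_ediag // => pd.
  by right; exists i, d.
move=> rt; apply/andP; split.
  case: rt => [[i [j [d [ij ->]]]]|[i [d [d0 pd ->]]]]; last by rewrite inG_ediag.
  by rewrite inGE // wz_eswap ?inE ?pdvd0.
rewrite eqn_leq (refl_type_codim_le rt) lt0n codimfix_mx subn_eq0 -ltnNge.
rewrite ltn_neqAle ncyc_len andbT; apply/eqP => /ncyc0_one te.
case: rt => [[i [j [d [ij e]]]]|[i [d [d0 pd e]]]]; move: te; rewrite e.
  by case=> /permP/(_ i); rewrite tpermL perm1 => /esym/eqP; rewrite (negbTE ij).
by case=> /ffunP/(_ i); rewrite !ffunE eqxx => /eqP; rewrite (negbTE d0).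
Qed.
End Length.

(** * The two orders *)

Section Orders.
Variables m' n p : nat.
Notation m := m'.+1.
Notation elt := (elt m n).
Hypothesis pm : (p %| m)%N.
Implicit Types (x y z t w : elt) (v : 'I_m) (s : seq elt).

Lemma codimfix_emul_le x y :
  (codimfix (mx (emul x y)) <= codimfix (mx x) + codimfix (mx y))%N.
Proof. by rewrite mx_mul codimfixM. Qed.

Lemma codimfix_einv x : codimfix (mx (einv x)) = codimfix (mx x).
Proof. by rewrite -mx_inv codimfix_inv ?mx_unit. Qed.

Lemma is_reflection_codim (q : nat) t : is_reflection q t -> codimfix (mx t) = 1%N.
Proof. by case/andP=> _ /eqP. Qed.

Lemma refl_type_codim (q : nat) t : (q %| m)%N -> refl_type q t ->
  codimfix (mx t) = 1%N.
Proof. by move=> qm /(is_reflectionP _ qm)/is_reflection_codim. Qed.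

Lemma is_reflection_inG (q : nat) t : is_reflection q t -> inG q t.
Proof. by case/andP. Qed.

Lemma codimfix_prodmx s : all (@is_reflection m p n) s ->
  (codimfix (prodmx s) <= size s)%N.
Proof.
elim: s => [|t s IH] /=; first by rewrite codimfix1.
case/andP => /is_reflection_codim rt /IH le_s.
by apply: leq_trans (codimfixM _ _) _; rewrite rt add1n ltnS.
Qed.

Lemma prodmx_inG s : all (@is_reflection m p n) s ->
  exists2 x : elt, inG p x & prodmx s = mx x.
Proof.
elim: s => [|t s IH] /=; first by exists (eone m' n); rewrite ?inG_one ?mx_one.
case/andP => rt /IH[x Gx ->]; exists (emul t x); last by rewrite mx_mul.
by rewrite inG_mul // is_reflection_inG.
Qed.

(** Conjugation preserves the codimension and the total weight, which by [is_reflectionP] decide the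
    matter. *)
Lemma refl_type_conj (q : nat) x t : (q %| m)%N ->
  refl_type q t -> refl_type q (emul (einv x) (emul t x)).
Proof.
move=> qm /(is_reflectionP _ qm)/andP[Gt /eqP c1]; apply/(is_reflectionP _ qm)/andP.
split; last by rewrite !mx_mul -mx_inv mulmxA codimfix_conj ?mx_unit ?c1.
have tw y z : wz (emul y z).2 setT = wz z.2 setT + wz y.2 setT.
  by rewrite wz_emul // => i; rewrite !inE.
have tV : wz x.2 setT + wz (einv x).2 setT = 0.
  by rewrite -tw eVmul /wz big1 // => i _; rewrite ffunE.
move: Gt; rewrite !inGE // !tw addrAC addrC => Gt.
by rewrite tV addr0.
Qed.

Lemma emul_left x t : emul t x = emul x (emul (einv x) (emul t x)).
Proof. by rewrite emulA emulV e1mul. Qed.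

Lemma ncyc_raise_left (q : nat) x t : (q %| m)%N -> refl_type q t ->
  ncyc (emul t x) 0 = (ncyc x 0).+1 ->
  (forall v, v != 0 -> (ncyc (emul t x) v <= ncyc x v)%N) /\
  (paired q (ncyc (emul t x)) <-> paired q (ncyc x)).
Proof.
move=> qm rt; rewrite emul_left; apply: ncyc_raise => //; exact: refl_type_conj.
Qed.

Lemma lR_of_paired x : paired p (ncyc x) -> lR m p (mx x) (codimfix (mx x)).
Proof.
move=> Qx; split; last by move=> s rs <-; exact: codimfix_prodmx.
have [s [rs ss ps]] := refl_factorization pm Qx; exists s; split.
  by apply/allP => t /rs /(is_reflectionP _ pm).
by rewrite codimfix_mx.
Qed.

Lemma paired_one : paired p (ncyc (eone m' n)).
Proof.
move=> v pv; have v0 : v != 0 by apply: contraNneq pv => ->; exact: pdvd0.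
by rewrite !ncyc_one oppr_eq0 (negbTE v0).
Qed.

(** When the length equals the codimension, each factor changes the codimension by exactly one, so
    [ncyc_raise_left] carries pairedness from the identity up to [x]. *)
Lemma paired_of_short s x : all (@is_reflection m p n) s -> prodmx s = mx x ->
  size s = codimfix (mx x) -> paired p (ncyc x).
Proof.
elim: s x => [|t s IH] x /=.
  by rewrite -(mx_one m' n) => _ /mx_inj <- _; exact: paired_one.
case/andP => rt rs px sx.
have rtV : refl_type p (einv t) by apply/refl_typeV/(is_reflectionP _ pm).
pose y := emul (einv t) x.
have py : prodmx s = mx y by rewrite mx_mul -px -mx_inv mulKmx ?mx_unit.
have cy : (codimfix (mx y) <= size s)%N by rewrite -py codimfix_prodmx.
have cx : (codimfix (mx x) <= 1 + codimfix (mx y))%N.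
  by rewrite -px py -(is_reflection_codim rt) codimfixM.
have e : codimfix (mx x) = (codimfix (mx y)).+1 by lia.
apply/(ncyc_raise_left pm rtV (codimfix_raise e)).2.
by apply: (IH y rs py); lia.
Qed.

Lemma lR_codimfix x k : lR m p (mx x) k -> (codimfix (mx x) <= k)%N.
Proof. by case=> [[s [rs [<- <-]]] _]; exact: codimfix_prodmx. Qed.

Lemma lR_uniq (g : 'M[algC]_n) j k : lR m p g j -> lR m p g k -> j = k.
Proof.
move=> [[s [rs [<- ps]]] min_j] [[s' [rs' [<- ps']]] min_k].
by apply/eqP; rewrite eqn_leq min_j // min_k.
Qed.

Lemma lR_paired x : lR m p (mx x) (codimfix (mx x)) -> paired p (ncyc x).
Proof. by case=> [[s [rs [ss ps]]] _]; exact: (paired_of_short rs ps). Qed.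

(** Additivity forces each reflection peeled off on the left to lower the codimension by one, and
    such a step raises no multiplicity of a nonzero weight. *)
Lemma ncyc_chain_left s x y : (forall t, t \in s -> refl_type 1 t) ->
  mx y = prodmx s *m mx x -> codimfix (mx y) = (codimfix (mx x) + size s)%N ->
  forall v, v != 0 -> (ncyc x v <= ncyc y v)%N.
Proof.
elim: s y => [|t s IH] y rs /=; first by rewrite mul1mx => /mx_inj ->.
move=> py cy v v0; have rt := rs t (mem_head _ _).
have rs' u : u \in s -> refl_type 1 u by move=> us; apply: rs; rewrite inE us orbT.
have rtV := refl_typeV (dvd1n m) rt.
pose y' := emul (einv t) y.
have py' : mx y' = prodmx s *m mx x.
  by rewrite mx_mul py -mx_inv -mulmxA mulKmx ?mx_unit.
have c1 : (codimfix (mx y') <= size s + codimfix (mx x))%N.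
  rewrite py'; apply: leq_trans (codimfixM _ _) _; rewrite leq_add2r.
  elim: s rs' {IH rs py cy py'} => [|u s IH] rs /=; first by rewrite codimfix1.
  apply: leq_trans (codimfixM _ _) _; rewrite -[(size s).+1]/(1 + size s)%N leq_add //.
    by rewrite (refl_type_codim (dvd1n m) (rs u _)) ?mem_head.
  by apply: IH => r rs'; apply: rs; rewrite inE rs' orbT.
have c2 : (codimfix (mx y) <= 1 + codimfix (mx y'))%N.
  rewrite -(refl_type_codim (dvd1n m) rt); have -> : y = emul t y'.
    by rewrite /y' emulA emulV e1mul.
  exact: codimfix_emul_le.
have e : codimfix (mx y) = (codimfix (mx y')).+1 by lia.
have [mono _] := ncyc_raise_left (dvd1n m) rtV (codimfix_raise e).
apply: leq_trans (mono v v0); apply: (IH y') => //; lia.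
Qed.

Lemma le_cdfE x w : le_cdf x w <->
  (codimfix (mx x) + codimfix (mx (emul (einv x) w)) = codimfix (mx w))%N.
Proof. by rewrite /le_cdf mx_inv -mx_mul. Qed.

Lemma le_lRE x w : le_lR p x w <-> exists a b c, [/\ lR m p (mx x) a,
  lR m p (mx (emul (einv x) w)) b, lR m p (mx w) c & (a + b = c)%N].
Proof.
rewrite /le_lR mx_inv -mx_mul.
by split=> [[a [b [c [h1 [h2 [h3 h4]]]]]]|[a [b [c [h1 h2 h3 h4]]]]]; exists a, b, c.
Qed.

Lemma le_cdf_quotient_ncyc x w v : le_cdf x w -> v != 0 ->
  (ncyc (emul (einv x) w) v <= ncyc w v)%N.
Proof.
move=> /le_cdfE e v0.
have [s [rs ss ps]] := refl_factorization (dvd1n m) (paired1 (ncyc x)).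
apply: (ncyc_chain_left rs) => //.
  by rewrite ps -mx_mul emulA emulV e1mul.
by rewrite ss -codimfix_mx addnC.
Qed.

(* The quotient [z = x^-1 w] gives [w = x z = (x z x^-1) x]. *)
Lemma le_cdf_ncyc x w v : le_cdf x w -> v != 0 -> (ncyc x v <= ncyc w v)%N.
Proof.
move=> /le_cdfE e v0; pose z := emul w (einv x).
have zx : emul (einv z) w = x.
  have -> : w = emul z x by rewrite emulVK.
  by rewrite emulA eVmul e1mul.
rewrite -zx; apply: le_cdf_quotient_ncyc => //; apply/le_cdfE; rewrite zx -e addnC.
congr (_ + _)%N; have -> : z = emul x (emul (emul (einv x) w) (einv x)).
  by rewrite -!emulA [emul x _]emulA emulV e1mul.
have := codimfix_conj (mx (emul (einv x) w)) (mx_unit (einv x)).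
by rewrite mx_inv einvK -!mx_mul -emulA.
Qed.

(* Every tail of a shortest factorization of [w] is paired: a reflection that
   changes the codimension preserves pairedness, and one that does not is
   excluded by [no_flat_reflection]. *)
Lemma paired_of_interval w k : lR m p (mx w) k ->
  (forall x, inG p x -> le_lR p x w -> le_cdf x w) -> paired p (ncyc w).
Proof.
move=> lw sub; have [[s [rs [sk ps]]] mins] := lw.
(* Both pieces of a cut shortest factorization are themselves shortest, so the prefix lies below [w]
   for the reflection length and the assumption makes codimensions additive. *)
have split_cdf s1 s2 x y : s = s1 ++ s2 -> prodmx s1 = mx x -> prodmx s2 = mx y ->
    (codimfix (mx x) + codimfix (mx y) = codimfix (mx w))%N.
  move=> es px py.
  have [r1 r2] : all (@is_reflection m p n) s1 /\ all (@is_reflection m p n) s2.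
    by apply/andP; rewrite -all_cat -es.
  have xyw : emul x y = w by apply: mx_inj; rewrite mx_mul -px -py -prodmx_cat -es.
  have yE : emul (einv x) w = y by rewrite -xyw emulA eVmul e1mul.
  have Gx : inG p x.
    by have [x' Gx' /eqP] := prodmx_inG r1; rewrite px => /eqP/mx_inj ->.
  have /le_cdfE : le_cdf x w; last by rewrite yE.
  apply: (sub x Gx); apply/le_lRE.
  exists (size s1), (size s2), k; split=> //.
  - split; first by exists s1.
    move=> u ru pu; have := mins (u ++ s2); rewrite all_cat ru r2 prodmx_cat pu py.
    by rewrite -mx_mul xyw -sk es !size_cat leq_add2r; apply.
  - rewrite yE; split; first by exists s2.
    move=> u ru pu; have := mins (s1 ++ u); rewrite all_cat ru r1 prodmx_cat pu px.
    by rewrite -mx_mul xyw -sk es !size_cat leq_add2l; apply.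
  - by rewrite -size_cat -es.
suff tail s2 : forall s1 y, s = s1 ++ s2 -> prodmx s2 = mx y -> paired p (ncyc y).
  exact: (tail s [::] w).
elim: s2 => [|t s2 IH] s1 u es pu.
  by move: pu; rewrite /= -(mx_one m' n) => /mx_inj <-; exact: paired_one.
have : all (@is_reflection m p n) (s1 ++ t :: s2) by rewrite -es.
rewrite all_cat /= => /and3P[r1 rt r2].
have [x Gx px] := prodmx_inG r1; have [y Gy py] := prodmx_inG r2.
have Qy : paired p (ncyc y) by apply: (IH (rcons s1 t)); rewrite ?cat_rcons.
have uE : u = emul t y by apply: mx_inj; rewrite -pu /= py mx_mul.
have c1 := split_cdf _ _ _ _ es px pu.
have c2 : (codimfix (mx (emul x t)) + codimfix (mx y) = codimfix (mx w))%N.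
  by apply: (split_cdf (rcons s1 t) s2); rewrite ?cat_rcons // prodmx_rcons px mx_mul.
have t1 := is_reflection_codim rt; move/(is_reflectionP _ pm) in rt.
have up : (codimfix (mx u) <= 1 + codimfix (mx y))%N.
  by rewrite uE -t1 codimfix_emul_le.
have yE : y = emul (einv t) u by rewrite uE emulA eVmul e1mul.
have dn : (codimfix (mx y) <= 1 + codimfix (mx u))%N.
  by rewrite {1}yE -t1 -(codimfix_einv t); exact: codimfix_emul_le.
have [lt|gt|eq] := ltngtP (codimfix (mx u)) (codimfix (mx y)).
- have /codimfix_raise : codimfix (mx y) = (codimfix (mx u)).+1 by lia.
  by rewrite uE => /(ncyc_raise_left pm rt)[_ ->].
- have /codimfix_raise : codimfix (mx u) = (codimfix (mx y)).+1 by lia.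
  rewrite {1}yE => /(ncyc_raise_left pm (refl_typeV pm rt))[_ <-].
  by rewrite -yE.
(* If u and y have equal codimension, comparing the cuts before and after [t] gives codim(xt) =
   codim(x) as well, so [t] is flat on both sides. *)
have wE : mx w = mx x *m (mx t *m mx y).
  by rewrite -ps es prodmx_cat px /= py.
have Uu : unitary (mx t *m mx y) by rewrite -mx_mul; exact: mx_unitary.
have e1 : codimfix (mx x *m mx t) = codimfix (mx x).
  by rewrite -mx_mul; apply/(@addIn (codimfix (mx y))); rewrite c2 -c1 eq.
have e2 : codimfix (mx t *m mx y) = codimfix (mx y) by rewrite -mx_mul -uE.
case: (no_flat_reflection (mx_unit x) (mx_unit t) (mx_unit y) (mx_unitary x)
  (mx_unitary t) Uu t1 e1 e2).
by rewrite -wE -mx_mul -uE c1.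
Qed.
End Orders.

(** * Pairing up weights *)

Lemma partition_setU1D (T : finType) (S B : {set T}) (P : {set {set T}}) :
  B != set0 -> B \subset S -> partition P (S :\: B) -> partition (B |: P) S.
Proof.
move=> B0 BS partP; have := partitionU1 partP B0.
rewrite setDE setUIr setUCr setIT (setUidPr BS); apply.
by rewrite disjoint_sym disjoints_subset subsetIr.
Qed.

Section Pairing.
Variables m' n p : nat.
Notation m := m'.+1.
Hypothesis pm : (p %| m)%N.
Variable a : {ffun 'I_n -> 'I_m}.
Implicit Types (S B : {set {set 'I_n}}) (C : {set 'I_n}) (v : 'I_m).

Definition nwt S v : nat := \sum_(C in S) (wz a C == v).

Lemma nwt_setD1 S C v : C \in S ->
  nwt S v = ((wz a C == v) + nwt (S :\ C) v)%N.
Proof. by move=> CS; rewrite /nwt (big_setD1 C CS). Qed.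

Lemma nwt_gt0 S v : (0 < nwt S v)%N -> exists2 C, C \in S & wz a C = v.
Proof.
have [/exists_inP[C CS /eqP Cv] _|/exists_inPn h] :=
  boolP [exists C in S, wz a C == v]; first by exists C.
by rewrite /nwt big1 // => C /h /negbTE ->.
Qed.

Lemma sum_wtset S :
  ((\sum_(C in S) wtset a C) %% m)%N = (\sum_(C in S) wz a C)%R :> nat.
Proof.
elim/big_rec2: _ => [|C y1 y2 _ IH]; first by rewrite mod0n.
by rewrite /= wtsetE -modnDmr IH.
Qed.

Lemma sum_wtset_modp S :
  ((\sum_(C in S) wtset a C) %% p == 0)%N = pdvd p (\sum_(C in S) wz a C).
Proof. by rewrite /pdvd -sum_wtset /dvdn modn_dvdm. Qed.

Lemma sum_wz_nwt S : \sum_(C in S) wz a C = \sum_v v *+ nwt S v.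
Proof.
rewrite (partition_big (wz a) xpredT) //=; apply: eq_bigr => v _.
rewrite (eq_bigr (fun=> v)) => [|C /andP[_ /eqP] //].
rewrite sumr_const; congr (_ *+ _); rewrite /nwt -sum1_card big_mkcondr /=.
by apply: eq_bigr => C _; case: eqP.
Qed.

(** Pairedness adds up over blocks: an allowed singleton contributes only a weight divisible by [p],
    and a pair contributes opposite weights. *)
Lemma paired_of_partition b S : good_partition p a b S -> paired p (nwt S).
Proof.
move=> [P [partP blocks]].
have nE v : nwt S v = (\sum_(B in P) nwt B v)%N.
  by rewrite /nwt (set_partition_big _ partP).
have QB B : B \in P -> paired p (nwt B).
  move=> /blocks /orP[/andP[_ /existsP[C /andP[/eqP -> pC]]]|].
    apply/(eq_paired (N' := fun=> 0%N)) => // v pv; rewrite /nwt big_set1.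
    by case: eqP => // e; move: pv; rewrite -e /pdvd -wtsetE /dvdn pC.
  case/andP => /cards2P[C [C' [CC' ->]]] s0.
  have s : wz a C + wz a C' = 0.
    apply: val_inj => /=; move: s0; rewrite sum_wtset big_setU1 ?inE //= big_set1.
    by move/eqP.
  have C'E : wz a C' = - wz a C by apply/eqP; rewrite -addr_eq0 addrC s.
  apply/(@paired_add_pair _ p _ (fun=> 0%N) (wz a C)) => // v v0.
  by rewrite /nwt big_setU1 ?inE //= big_set1 C'E.
move=> v pv; rewrite !nE; split; first by apply: eq_bigr => B /QB/(_ v pv)[].
move=> vN; elim/big_ind: _ => // [j k|B /QB/(_ v pv)[_]]; last exact.
by rewrite oddD => /negbTE -> /negbTE ->.
Qed.

(** Blocks are removed greedily: a cycle of weight divisible by [p] alone, any other cycle with an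
    opposite partner. *)
Lemma partition_of_paired b S : paired p (nwt S) ->
  (b || [forall C in S, ~~ pdvd p (wz a C)]) -> good_partition p a b S.
Proof.
have [N] := ubnP #|S|; elim: N S => // N IH S ltN QS single.
have [->|[C CS]] := set_0Vmem S.
  exists set0; split; last by move=> B; rewrite inE.
  by rewrite partition_set0 eqxx.
have sub_single B : b || [forall C in S :\: B, ~~ pdvd p (wz a C)].
  case/orP: single => [->//|/forall_inP h]; apply/orP; right.
  by apply/forall_inP => D; rewrite inE => /andP[_ /h].
have step B : B != set0 -> B \subset S -> paired p (nwt (S :\: B)) ->
   (b && [exists C, (B == [set C]) && (wtset a C %% p == 0)%N])
      || ((#|B| == 2) && ((\sum_(C in B) wtset a C) %% m == 0)%N) ->
   good_partition p a b S.
  move=> B0 BS QB okB; have [|P [partP okP]] := IH (S :\: B) _ QB (sub_single B).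
    rewrite -ltnS; apply: leq_trans _ ltN; rewrite ltnS; apply: proper_card.
    apply/properP; split; first exact: subsetDl.
    by case/set0Pn: B0 => D DB; exists D; rewrite ?(subsetP BS) // inE DB.
  exists (B |: P); split; first exact: partition_setU1D.
  by move=> D; rewrite !inE => /orP[/eqP -> //|/okP].
have [pC|pC] := boolP (pdvd p (wz a C)).
  have bT : b.
    by case/orP: single => // /forall_inP/(_ C CS); rewrite pC.
  apply: (step [set C]); rewrite ?sub1set //.
  - by apply/set0Pn; exists C; rewrite inE.
  - apply/(eq_paired pm _).2: QS => v pv; rewrite (nwt_setD1 v CS).
    by case: eqP => // e; rewrite -e pC in pv.
  - by rewrite bT; apply/orP; left; apply/existsP; exists C; rewrite eqxx wtsetE.
(* For a self-opposite weight, even multiplicity supplies a second cycle distinct from [C]. *)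
have [C' C'S C'E] : exists2 C', C' \in S :\ C & wz a C' = - wz a C.
  apply: nwt_gt0; rewrite lt0n; apply/eqP => e0.
  have [e1 e2] := QS _ pC; move: e1 e2; rewrite !(nwt_setD1 _ CS) eqxx e0.
  have [e|_] := eqVneq (wz a C) (- wz a C); last by [].
  by move=> -> /(_ e); rewrite addn0.
have SD : S :\: [set C; C'] = S :\ C :\ C' by rewrite setDDl.
apply: (step [set C; C']).
- by apply/set0Pn; exists C; rewrite !inE eqxx.
- by move: C'S; rewrite subUset !sub1set CS inE => /andP[].
- rewrite SD; apply/(paired_add_pair (b := wz a C) pm _).1: QS => v v0.
  rewrite (nwt_setD1 _ CS) (nwt_setD1 _ C'S) C'E.
  by move: (nat_of_bool _) (nat_of_bool _) (nwt _ _) => *; lia.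
have CC' : C != C' by move: C'S; rewrite !inE eq_sym => /andP[].
have s0 : \sum_(D in [set C; C']) wz a D = 0.
  by rewrite big_setU1 ?inE // big_set1 C'E /= subrr.
by apply/orP; right; rewrite cards2 CC' sum_wtset s0.
Qed.

(** Cycles of surplus nonzero weight are deleted one by one. This realizes the weights of an element
    below [w] by cycles of [w]. *)
Lemma subset_nwt (N : 'I_m -> nat) S :
  (forall v, v != 0 -> (N v <= nwt S v)%N) ->
  exists2 S' : {set {set 'I_n}}, S' \subset S & forall v, v != 0 -> nwt S' v = N v.
Proof.
have [k] := ubnP #|S|; elim: k S => // k IH S ltk le.
have [/existsP[v /andP[v0 lt]]|/existsPn h] :=
    boolP [exists v, (v != 0) && (N v < nwt S v)%N]; last first.
  exists S => // v v0; apply/eqP; rewrite eqn_leq le // andbT leqNgt.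
  by have := h v; rewrite v0.
have [C CS Cv] := nwt_gt0 (leq_ltn_trans (leq0n _) lt).
have [||S' S'S e] := IH (S :\ C).
- by move: ltk; rewrite (cardsD1 C S) CS.
- move=> u u0; have := le u u0; rewrite (nwt_setD1 u CS) Cv.
  have [<-|_] := eqVneq v u; last by [].
  by move: lt; rewrite (nwt_setD1 v CS) Cv eqxx.
by exists S' => //; apply: subset_trans S'S (subsetDl _ _).
Qed.
End Pairing.

(** * Restriction to a set of cycles *)

Section Restriction.
Variables m' n : nat.
Notation m := m'.+1.
Notation elt := (elt m n).
Implicit Types (x y z w : elt) (S : {set {set 'I_n}}) (U C : {set 'I_n}) (v : 'I_m).

(** A relation, because such an element exists only when [U] is stable under [w.1]. *)
Definition restricts w U x :=
  (forall i, x.1 i = if i \in U then w.1 i else i) /\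
  (forall i, x.2 i = if i \in U then w.2 i else 0).

Lemma restriction_exists w U : (forall i, (w.1 i \in U) = (i \in U)) ->
  exists x, restricts w U x.
Proof.
move=> wU; pose f i := if i \in U then w.1 i else i.
have f_inj : injective f.
  move=> i j; rewrite /f; case: ifP => iU; case: ifP => jU //.
  - exact: perm_inj.
  - by move=> e; rewrite -e wU iU in jU.
  - by move=> e; rewrite e wU jU in iU.
exists (perm f_inj, [ffun i => if i \in U then w.2 i else 0]).
by split=> i; rewrite /= ?permE ?ffunE.
Qed.

Lemma restricts_mul w U x z : (forall i, (w.1 i \in U) = (i \in U)) ->
  restricts w U x -> restricts w (~: U) z -> emul x z = w.
Proof.
move=> wU [x1 x2] [z1 z2]; rewrite [RHS]surjective_pairing; congr pair.
  apply/permP => i; rewrite permM z1 x1 !inE.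
  by case: (boolP (i \in U)) => iU /=; rewrite ?wU ?iU ?(negbTE iU).
apply/ffunP => i; rewrite ffunE z2 z1 x2 !inE.
by case: (boolP (i \in U)) => iU /=; rewrite ?wU ?iU ?(negbTE iU) ?add0r ?addr0.
Qed.

Lemma cover_closed w S i : S \subset cycles w -> (w.1 i \in cover S) = (i \in cover S).
Proof.
move=> Sw; apply/bigcupP/bigcupP => -[C CS iC]; exists C => //;
  by move: iC; rewrite (porbits_closed _ (subsetP Sw _ CS)).
Qed.

Lemma cycles_restricts w S x : S \subset cycles w -> restricts w (cover S) x ->
  cycles x = S :|: (set1 @: ~: cover S).
Proof.
move=> Sw [x1 _]; have inU i : i \in cover S -> porbit w.1 i \in S.
  by case/bigcupP => C CS iC; rewrite -(porbitsP (subsetP Sw _ CS) iC).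
have poU i : i \in cover S -> porbit x.1 i = porbit w.1 i.
  move=> iU; apply: eq_porbit_in => j jw; rewrite x1 (_ : j \in _) //.
  by apply/bigcupP; exists (porbit w.1 i); rewrite ?inU.
have poN i : i \notin cover S -> porbit x.1 i = [set i].
  move=> iU; apply/eqP; rewrite eqEsubset sub1set porbit_id andbT.
  apply: porbit_sub; last exact: set11.
  by move=> j /set1P ->; rewrite x1 (negbTE iU) set11.
apply/setP => D; rewrite inE; apply/imsetP/orP => [[i _ ->]|[DS|/imsetP[i iU ->]]].
- have [iU|iU] := boolP (i \in cover S); first by left; rewrite poU ?inU.
  by right; rewrite poN // imset_f // inE.
- have /imsetP[i _ Di] := subsetP Sw D DS; exists i => //.
  by rewrite poU // -?Di //; apply/bigcupP; exists D; rewrite // Di porbit_id.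
- by exists i => //; rewrite poN //; rewrite inE in iU.
Qed.

(** Points outside the chosen cycles become fixed points of weight 0, so they affect only the count
    at 0. *)
Lemma ncyc_restricts w S x v : S \subset cycles w -> restricts w (cover S) x ->
  ncyc x v = (nwt w.2 S v + (if v == 0%R then n - #|cover S| else 0))%N.
Proof.
move=> Sw rx; have [_ x2] := rx.
rewrite /ncyc (cycles_restricts Sw rx).
have dis : [disjoint S & (set1 @: ~: cover S)].
  apply/pred0Pn => -[D /andP[/= DS /imsetP[i iU De]]].
  move: iU; rewrite inE => /negP; apply; apply/bigcupP.
  by exists D => //; rewrite De set11.
rewrite (eq_bigl [predU S & (set1 @: ~: cover S)]); last by move=> D; rewrite !inE.
rewrite bigU //=; congr (_ + _)%N.
  apply: eq_bigr => C CS; congr (nat_of_bool (_ == _)); apply: eq_bigr => i iC.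
  by rewrite x2 (_ : i \in _) //; apply/bigcupP; exists C.
rewrite big_imset /=; last by move=> ? ? _ _ /set1_inj.
rewrite (eq_bigr (fun=> nat_of_bool (v == 0))) => [|i iU]; last first.
  by rewrite /wz big_set1 x2; move: iU; rewrite inE => /negbTE ->; rewrite eq_sym.
have := cardsC (cover S); rewrite sum_nat_const card_ord => e.
by case: eqP => _; rewrite ?muln0 // muln1 -[X in (X - _)%N]e addKn.
Qed.

Lemma wz_total x : wz x.2 setT = \sum_(C in cycles x) wz x.2 C.
Proof. by rewrite {1}/wz (set_partition_big _ (porbits_partition x.1)). Qed.

Lemma wz_total_eq w S x : (forall v, v != 0 -> ncyc x v = nwt w.2 S v) ->
  wz x.2 setT = \sum_(C in S) wz w.2 C.
Proof.
move=> e; rewrite wz_total !sum_wz_nwt; apply: eq_bigr => v _.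
have [->|v0] := eqVneq v 0; first by rewrite !mul0rn.
by rewrite -(e v v0).
Qed.

(** The quotient is the restriction of [w] to the remaining cycles; the weight-0 cycles of [w] are
    shared between the two, so codimensions add. *)
Lemma le_cdf_restricts w S x : S \subset cycles w -> restricts w (cover S) x ->
  le_cdf x w.
Proof.
move=> Sw rx; pose S' := cycles w :\: S.
have S'w : S' \subset cycles w by exact: subsetDl.
have covE : ~: cover S = cover S'.
  apply/setP => i; rewrite inE; apply/idP/bigcupP => [iU|[C]].
    exists (porbit w.1 i); rewrite ?porbit_id // inE imset_f // andbT.
    apply: contraNN iU => iS; apply/bigcupP.
    by exists (porbit w.1 i); rewrite ?porbit_id.
  rewrite inE => /andP[CS Cw] iC; apply: contraNN CS => /bigcupP[D DS iD].
  by rewrite (porbitsP Cw iC) -(porbitsP (subsetP Sw _ DS) iD).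
have [z rz] := restriction_exists (fun i => cover_closed i S'w).
have xz : emul x z = w.
  by apply: (restricts_mul (fun i => cover_closed i Sw) rx); rewrite covE.
apply/le_cdfE; have -> : emul (einv x) w = z by rewrite -xz emulA eVmul e1mul.
have nE : ncyc w 0%R = (nwt w.2 S 0%R + nwt w.2 S' 0%R)%N.
  rewrite /ncyc (big_setID S) /= /nwt; congr (_ + _)%N.
  apply: eq_bigl => C; rewrite inE andbC.
  by case: (boolP (C \in S)) => // /(subsetP Sw) ->.
have cE := cardsC (cover S); rewrite covE card_ord in cE.
have := ncyc_len x 0; have := ncyc_len z 0.
rewrite !codimfix_mx (ncyc_restricts _ Sw rx) (ncyc_restricts _ S'w rz) nE eqxx.
by lia.
Qed.
End Restriction.

(** * Equality of intervals and the two pairing conditions *)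

Lemma interval_eq_iff m' p n (w : elt m'.+1 n) :
  (p %| m'.+1)%N -> inG p w ->
  ((forall x : elt m'.+1 n, inG p x -> (le_lR p x w <-> le_cdf x w)) <->
   (good_partition p w.2 false [set C in cycles w | wtset w.2 C %% p != 0]%N /\
    (forall S : {set {set 'I_n}}, S \subset cycles w ->
        ((\sum_(C in S) wtset w.2 C) %% p == 0)%N ->
        good_partition p w.2 true S))).
Proof.
move=> pm Gw; split=> [eqI|[_ cond2]].
  have le_ww : le_cdf w w by apply/le_cdfE; rewrite eVmul mx_one codimfix1 addn0.
  (* Equality of the intervals at [w] itself provides a reflection length for [w]. *)
  have [_ [_ [c [_ _ lw _]]]] := (le_lRE _ _ _).1 ((eqI w Gw).2 le_ww).
  have Qw : paired p (ncyc w).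
    by apply: (paired_of_interval pm lw) => x Gx; exact: (eqI x Gx).1.
  split.
    apply: partition_of_paired => //.
      apply/(eq_paired pm _).2: Qw => v pv; rewrite /ncyc /nwt.
      rewrite big_mkcond [RHS]big_mkcond; apply: eq_bigr => C _; rewrite inE.
      case: (C \in _) => //=; case: (boolP (_ == v)) => [/eqP Cv|_]; last by case: ifP.
      by rewrite wtsetE Cv (pv : _ %% _ != 0)%N.
    by apply/forall_inP => C; rewrite inE wtsetE => /andP[].
  move=> S Sw; rewrite sum_wtset_modp // => pS.
  have [x rx] := restriction_exists (fun i => cover_closed i Sw).
  have nx v : v != 0 -> ncyc x v = nwt w.2 S v.
    by move=> v0; rewrite (ncyc_restricts _ Sw rx) (negbTE v0) addn0.
  have Gx : inG p x by rewrite inGE // (wz_total_eq nx).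
  have lecdf := le_cdf_restricts Sw rx.
  have [a [b [c' [la lb lc' abc]]]] := (le_lRE _ _ _).1 ((eqI x Gx).2 lecdf).
  have c'E := lR_uniq lc' (lR_of_paired pm Qw).
  move/le_cdfE in lecdf.
  (* Reflection lengths dominate codimensions, and both pairs of values add up to the codimension of
     [w], so they agree termwise. *)
  have aE : a = codimfix (mx x).
    by have := lR_codimfix la; have := lR_codimfix lb; lia.
  rewrite aE in la; have Qx := lR_paired pm la.
  apply: partition_of_paired => //; apply/(eq_paired pm _).1: Qx => v pv.
  by apply: nx; apply: contraNneq pv => ->; exact: pdvd0.
(* The nonzero weights of [x] are those of some set of cycles of [w]; its weight sum is divisible by
   [p] because [x] lies in G(m,p,n), so condition (2) applies to it. *)
have paired_below (x : elt m'.+1 n) : inG p x ->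
    (forall v, v != 0 -> (ncyc x v <= ncyc w v)%N) -> paired p (ncyc x).
  move=> Gx /subset_nwt[S Sw e].
  have e' v : v != 0 -> ncyc x v = nwt w.2 S v by move=> v0; rewrite e.
  have /paired_of_partition Q : good_partition p w.2 true S.
    by apply: cond2 => //; rewrite sum_wtset_modp // -(wz_total_eq e') -inGE.
  apply/(eq_paired pm _).2: (Q pm) => v pv.
  by apply: e'; apply: contraNneq pv => ->; exact: pdvd0.
have lw := lR_of_paired pm (paired_below w Gw (fun _ _ => leqnn _)).
move=> x Gx; have Gz : inG p (emul (einv x) w) by rewrite inG_mul ?inG_inv.
split.
  move/le_lRE => [a [b [c [la lb lc abc]]]]; apply/le_cdfE.
  have cE := lR_uniq lc lw.
  have := codimfix_emul_le x (emul (einv x) w); rewrite emulA emulV e1mul.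
  by have := lR_codimfix la; have := lR_codimfix lb; lia.
move=> le; apply/le_lRE.
exists (codimfix (mx x)), (codimfix (mx (emul (einv x) w))), (codimfix (mx w)).
split.
- by apply: (lR_of_paired pm); apply: (paired_below x Gx) => v; exact: le_cdf_ncyc.
- apply: (lR_of_paired pm); apply: (paired_below _ Gz) => v.
  exact: le_cdf_quotient_ncyc.
- exact: lw.
- exact: (le_cdfE x w).1.
Qed.

Local Close Scope ring_scope.

Theorem theorem1p1 (m p n : nat) (w : elt m n) :
  0 < m -> 0 < p -> 0 < n -> p %| m -> inG p w ->
  ((forall x : elt m n, inG p x -> (le_lR p x w <-> le_cdf x w)) <->
   (good_partition p w.2 false [set C in cycles w | wtset w.2 C %% p != 0] /\
    (forall S : {set {set 'I_n}}, S \subset cycles w ->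
        (\sum_(C in S) wtset w.2 C) %% p == 0 ->
        good_partition p w.2 true S))).
Proof. by case: m w => [|m'] w // _ _ _; exact: interval_eq_iff. Qed.
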